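(* Let $s\in\mathbb{N}$, $p,q\in[1,\infty]$, let $p^*$ be the conjugate of $p$ ($1/p+1/p^*=1$), and let $\boldsymbol{\gamma}=(\gamma_{\mathfrak{u}})_{\mathfrak{u}\subseteq[s]}$ be non-negative weights. Let $1\le k<s$, let $A_k$ be an algorithm for approximating functions from $F_{k,p,\boldsymbol{\gamma}}$, and let $A^{\mathrm{trnc}}_{s,k}$ be the algorithm for $F_{s,p,\boldsymbol{\gamma}}$ defined by $A^{\mathrm{trnc}}_{s,k}(f)=A_k(f_k)$, where $f_k(x_1,\dots,x_k)=f(x_1,\dots,x_k,0,\dots,0)$. Then the worst case error of $A^{\mathrm{trnc}}_{s,k}$ is bounded by \[ e(A^{\mathrm{trnc}}_{s,k};F_{s,p,\boldsymbol{\gamma}})\,\le\,\left([e(A_k;F_{k,p,\boldsymbol{\gamma}})]^{p^*}+\sum_{\mathfrak{u}\not\subseteq[k]}\frac{\gamma_{\mathfrak{u}}^{p^*}}{(\frac{q}{p^*}+1)^{p^*|\mathfrak{u}|/q}}\right)^{1/p^*}\quad\text{for }p>1, \] and by \[ e(A^{\mathrm{trnc}}_{s,k};F_{s,1,\boldsymbol{\gamma}})\,\le\,\max\left(e(A_k;F_{k,1,\boldsymbol{\gamma}}),\ \max_{\mathfrak{u}\not\subseteq[k]}\gamma_{\mathfrak{u}}\right)\quad\text{for }p=1, \] where the sum and maximum are over all $\mathfrak{u}\subseteq[s]$ with $\mathfrak{u}\not\subseteq[k]$. Moreover, if $\varepsilon>0$ and $k\ge\mathrm{dim}^{\mathrm{trnc}}(\varepsilon)$,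 then \[ e(A^{\mathrm{trnc}}_{s,k};F_{s,p,\boldsymbol{\gamma}})\,\le\,\left([e(A_k;F_{k,p,\boldsymbol{\gamma}})]^{p^*}+\varepsilon^{p^*}\right)^{1/p^*}, \] where for $p=1$ (i.e. $p^*=\infty$) the right-hand side is read as $\max(e(A_k;F_{k,1,\boldsymbol{\gamma}}),\varepsilon)$.
   Context: Notation: $[s]=\{1,\dots,s\}$, $[0]=\emptyset$; $\mathfrak{u},\mathfrak{v}$ denote subsets of $[s]$. For $\boldsymbol{x}\in[0,1]^s$, $[\boldsymbol{x}_{\mathfrak{u}};\boldsymbol{0}_{-\mathfrak{u}}]$ is the vector obtained from $\boldsymbol{x}$ by replacing $x_j$ by $0$ for all $j\notin\mathfrak{u}$. $f^{(\mathfrak{u})}=\prod_{j\in\mathfrak{u}}\frac{\partial}{\partial x_j}f$, $f^{(\emptyset)}=f$. For $q=\infty$ the number $(\frac{q}{p^*}+1)^{1/q}$ is read as its limiting value $1$. Spaces: Let $F$ be the space of absolutely continuous functions on $[0,1]$ vanishing at $0$ with derivative in $L_p([0,1])$, with norm $\|f\|_F=\|f'\|_{L_p}$. For nonempty $\mathfrak{u}\subseteq[s]$, $F_{\mathfrak{u}}$ is the completion of the span of the functions $f(\boldsymbol{x})=\prod_{j\in\mathfrak{u}}f_j(x_j)$, $f_j\in F$, on $[0,1]^s$ under the norm $\|f\|_{F_{\mathfrak{u}}}=\|f^{(\mathfrak{u})}\|_{L_p([0,1]^{|\mathfrak{u}|})}$. (Its elements are functions depending only on $x_j$, $j\in\mathfrak{u}$,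 vanishing if $x_j=0$ for some $j\in\mathfrak{u}$, of the form $f(\boldsymbol{x})=\int_{\prod_{j\in\mathfrak{u}}[0,x_j)}g(\boldsymbol{t})\,d\boldsymbol{t}$ with $g=f^{(\mathfrak{u})}\in L_p([0,1]^{|\mathfrak{u}|})$.) $F_\emptyset$ is the space of constant functions with norm $|\cdot|$. Let $\mathfrak{U}=\{\mathfrak{u}\subseteq[s]:\gamma_{\mathfrak{u}}>0\}$. The weighted anchored space is $F_{s,p,\boldsymbol{\gamma}}=\mathrm{span}\big(\bigcup_{\mathfrak{u}\in\mathfrak{U}}F_{\mathfrak{u}}\big)$ with norm $\|f\|_{F_{s,p,\boldsymbol{\gamma}}}=\big(\sum_{\mathfrak{u}\in\mathfrak{U}}\gamma_{\mathfrak{u}}^{-p}\|f^{(\mathfrak{u})}([\cdot_{\mathfrak{u}};\boldsymbol{0}_{-\mathfrak{u}}])\|_{L_p}^p\big)^{1/p}$ for $p<\infty$, and $\max_{\mathfrak{u}\in\mathfrak{U}}\gamma_{\mathfrak{u}}^{-1}\|f^{(\mathfrak{u})}([\cdot_{\mathfrak{u}};\boldsymbol{0}_{-\mathfrak{u}}])\|_{L_\infty}$ for $p=\infty$. Every $f\in F_{s,p,\boldsymbol{\gamma}}$ has a unique anchored decomposition $f=\sum_{\mathfrak{u}\in\mathfrak{U}}f_{\mathfrak{u}}$ with $f_{\mathfrak{u}}\in F_{\mathfrak{u}}$, and $f^{(\mathfrak{u})}([\cdot_{\mathfrak{u}};\boldsymbol{0}_{-\mathfrak{u}}])=f_{\mathfrak{u}}^{(\mathfrak{u})}$.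 For $k<s$, $F_{k,p,\boldsymbol{\gamma}}$ is the analogous space built with the weights $(\gamma_{\mathfrak{u}})_{\mathfrak{u}\subseteq[k]}$, regarded as a subspace of $F_{s,p,\boldsymbol{\gamma}}$ (functions depending only on $x_1,\dots,x_k$); the truncated function is $f_k=f([\cdot_{[k]};\boldsymbol{0}_{-[k]}])=\sum_{\mathfrak{v}\subseteq[k]}f_{\mathfrak{v}}\in F_{k,p,\boldsymbol{\gamma}}$. $\mathcal{L}_q$ is a fixed normed linear space containing $F_{s,p,\boldsymbol{\gamma}}$ as a subspace and such that $\|f_{\mathfrak{u}}\|_{\mathcal{L}_q}=\|f_{\mathfrak{u}}\|_{L_q([0,1]^{|\mathfrak{u}|})}$ for all $f_{\mathfrak{u}}\in F_{\mathfrak{u}}$, $\mathfrak{u}\in\mathfrak{U}$. Algorithms and error: An algorithm for $F_{m,p,\boldsymbol{\gamma}}$ ($m=k$ or $m=s$) is a map $A_m(f)=\phi(f(\boldsymbol{x}_1),\dots,f(\boldsymbol{x}_n))$ with $\boldsymbol{x}_j\in[0,1]^m$ and $\phi:\mathbb{R}^n\to\mathcal{L}_q$. Let $S_m(f)=f$ be the embedding of $F_{m,p,\boldsymbol{\gamma}}$ into $\mathcal{L}_q$. The worst case error of $A_m$ is the operator norm of $S_m-A_m$, i.e. \[ e(A_m;F_{m,p,\boldsymbol{\gamma}}):=\|S_m-A_m\|=\sup_{\|f\|_{F_{m,p,\boldsymbol{\gamma}}}\le1}\|f-A_m(f)\|_{\mathcal{L}_q}. \] Truncation dimension: $\mathrm{dim}^{\mathrm{trnc}}(\varepsilon)$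 is the smallest integer $k\ge0$ such that $\big\|\sum_{\mathfrak{u}\not\subseteq[k]}f_{\mathfrak{u}}\big\|_{\mathcal{L}_q}\le\varepsilon\,\big\|\sum_{\mathfrak{u}\not\subseteq[k]}f_{\mathfrak{u}}\big\|_{F_{s,p,\boldsymbol{\gamma}}}$ for all $f=\sum_{\mathfrak{u}\in\mathfrak{U}}f_{\mathfrak{u}}\in F_{s,p,\boldsymbol{\gamma}}$ (sums over $\mathfrak{u}\in\mathfrak{U}$ with $\mathfrak{u}\not\subseteq[k]$).
   Formalization: For p<∞ the algorithm A_k is additionally assumed positively homogeneous, A_k(ch)=cA_k(h) for c>0 and h in F_{k,p,γ} (e.g. linear); for arbitrary φ and the unit-ball worst case error the stated bound is false. *)

(* Defs.v *)
From HB Require Import structures.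
From mathcomp Require Import all_boot all_order all_algebra.
From mathcomp Require Import all_classical all_reals all_analysis.

Set Implicit Arguments.
Unset Strict Implicit.
Unset Printing Implicit Defensive.

Import Order.TTheory GRing.Theory Num.Def Num.Theory.
Import numFieldNormedType.Exports.

Local Open Scope classical_set_scope.
Local Open Scope ring_scope.

(** Points of R^n are n-tuples.  A function on [0,1]^n is represented by a
    function on all of [n.-tuple R] whose values off the cube are never
    significant: two such functions are identified when they agree on [cube].
    Coordinates are numbered from 0, so that [s] is ['I_s]. *)

Definition cube (R : realType) (n : nat) : set (n.-tuple R) :=
  [set x | forall i : 'I_n, 0 <= tnth x i <= 1].

Section unit_cube_measure.
Context {R : realType}.

Definition unit_itv_measure : set (measurableTypeR R) -> \bar R :=
  mrestr (@lebesgue_measure R) (measurable_itv `[(0 : R), 1]).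

HB.instance Definition _ := Measure.copy unit_itv_measure
  (mrestr (@lebesgue_measure R) (measurable_itv `[(0 : R), 1])).

Lemma unit_itv_measure_setT : unit_itv_measure [set: R] = 1%E.
Proof.
by rewrite /unit_itv_measure /mrestr setTI lebesgue_measure_itv/= lte_fin ltr01
  oppr0 adde0.
Qed.

HB.instance Definition _ :=
  Measure_isProbability.Build _ _ R unit_itv_measure unit_itv_measure_setT.

Definition tcons (n : nat) (x : measurableTypeR R * n.-tuple R) : n.+1.-tuple R :=
  [tuple of x.1 :: x.2].

Lemma measurable_tcons (n : nat) :
  measurable_fun [set: measurableTypeR R * n.-tuple R] (@tcons n).
Proof. by apply: measurable_cons; [exact: measurable_fst|exact: measurable_snd]. Qed.

HB.instance Definition _ (n : nat) :=
  isMeasurableFun.Build _ _ _ _ (@tcons n) (@measurable_tcons n).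

(** Lebesgue measure on [0,1]^n, as a measure on R^n concentrated on the cube. *)
Fixpoint cube_measure (n : nat) : probability (n.-tuple R) R :=
  match n with
  | 0 => \d_([tuple] : 0.-tuple R)
  | m.+1 => distribution ((unit_itv_measure \x cube_measure m)%E) (@tcons m)
  end.

End unit_cube_measure.

(** The norm of L_p([0,1]^n); [p] ranges over [1, +oo]. *)
Definition Lp_norm (R : realType) (p : \bar R) (n : nat) (g : n.-tuple R -> R) : \bar R :=
  Lnorm (cube_measure n) p (EFin \o g).

Definition Lp_fun (R : realType) (p : \bar R) (n : nat) (g : n.-tuple R -> R) : Prop :=
  g \in Lfun (cube_measure n) p.

Definition abs_cont01 (R : realType) (f : R -> R) : Prop :=
  forall e : R, 0 < e -> exists2 d : R, 0 < d &
    forall (n : nat) (a b : 'I_n -> R),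
      (forall i, [/\ 0 <= a i, a i <= b i & b i <= 1]) ->
      trivIset [set: 'I_n] (fun i => `]a i, b i[%classic) ->
      \sum_(i < n) (b i - a i) < d ->
      \sum_(i < n) `|f (b i) - f (a i)| < e.

(** [f] belongs to the univariate space F, with derivative [g] = f'. *)
Definition F_deriv (R : realType) (p : \bar R) (f g : R -> R) : Prop :=
  [/\ abs_cont01 f, f 0 = 0, g \in Lfun (@unit_itv_measure R) p &
      {ae (@unit_itv_measure R), forall t : R, is_derive t 1 f (g t)}].

Section anchored_spaces.
Context {R : realType}.
Implicit Types (p q : \bar R) (s n : nat).

(** The mixed derivatives, as functions on [0,1]^n, of the linear combinations
    of products f_1(x_1) ... f_n(x_n) with f_j in F.  For n = 0 these are the
    constants. *)
Definition tensor_deriv p n : set (n.-tuple R -> R) :=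
  [set h | exists (m : nat) (c : 'I_m -> R) (g : 'I_m -> 'I_n -> R -> R),
     (forall i j, exists f : R -> R, F_deriv p f (g i j)) /\
     h = fun t => \sum_(i < m) c i * \prod_(j < n) g i j (tnth t j)].

(** The derivatives of the elements of the completion of that span: the closure
    of [tensor_deriv p n] in L_p([0,1]^n), which is all of L_p([0,1]^n) when
    p < oo. *)
Definition completed_deriv p n : set (n.-tuple R -> R) :=
  [set g | Lp_fun p g /\ forall e : R, 0 < e ->
     exists2 h, tensor_deriv p h & (Lp_norm p (fun t => g t - h t)%R < e%:E)%E].

(** [0_(-u)] padding: the i-th entry of [t] is the coordinate with index the
    i-th element of [u]; the other coordinates are 0 (for [j] not in [u],
    [index j (enum u)] is out of range). *)
Definition pad s (u : {set 'I_s}) (t : #|u|.-tuple R) : s.-tuple R :=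
  [tuple nth 0 t (index j (enum u)) | j < s].

(** x |-> \int_{\prod_{j in u} [0, x_j)} g(t) dt *)
Definition mixed_primitive s (u : {set 'I_s}) (g : #|u|.-tuple R -> R)
    (x : s.-tuple R) : R :=
  \int[cube_measure #|u|]_(t in
    [set t : #|u|.-tuple R |
       forall i : 'I_#|u|, 0 <= tnth t i < tnth x (enum_val i)]) g t.

(** [f] belongs to F_u and f^(u) = [g] (up to a null set). *)
Definition Fu_deriv p s (u : {set 'I_s}) (f : s.-tuple R -> R)
    (g : #|u|.-tuple R -> R) : Prop :=
  completed_deriv p g /\ {in @cube R s, f =1 @mixed_primitive s u g}.

Definition Fu_space p s (u : {set 'I_s}) : set (s.-tuple R -> R) :=
  [set f | exists g, @Fu_deriv p s u f g].

(** The sum over the index family U = {u | gamma_u > 0}. *)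
Definition is_anchored_decomposition p s (gamma : {set 'I_s} -> R)
    (f : s.-tuple R -> R) (fu : {set 'I_s} -> s.-tuple R -> R) : Prop :=
  (forall u : {set 'I_s}, 0 < gamma u -> Fu_space p u (fu u)) /\
  {in @cube R s, forall x, f x = \sum_(u : {set 'I_s} | 0 < gamma u) fu u x}.

Definition anchored_space p s (gamma : {set 'I_s} -> R) : set (s.-tuple R -> R) :=
  [set f | exists fu, is_anchored_decomposition p gamma f fu].

Definition weighted_norm p s (gamma : {set 'I_s} -> R)
    (g : forall u : {set 'I_s}, #|u|.-tuple R -> R) : \bar R :=
  match p with
  | r%:E => ((\sum_(u : {set 'I_s} | (0 < gamma u)%R)
               ((gamma u) `^ (- r))%:E * poweR (Lp_norm p (g u)) r) `^ r^-1)%E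
  | _ => \big[maxe/0%E]_(u : {set 'I_s} | 0 < gamma u)
               ((gamma u)^-1%:E * Lp_norm p (g u))%E
  end.

(** [f] belongs to F_{s,p,gamma} and has norm [N]: [g u] is the derivative
    f^(u)([._u ; 0_(-u)]) = f_u^(u), where f_u is the component of [f] in F_u.
    As f_u and f_u^(u) (up to null sets) are determined by [f], so is [N]. *)
Definition is_anchored_norm p s (gamma : {set 'I_s} -> R)
    (f : s.-tuple R -> R) (N : \bar R) : Prop :=
  exists (fu : {set 'I_s} -> s.-tuple R -> R)
         (g : forall u : {set 'I_s}, #|u|.-tuple R -> R),
    [/\ is_anchored_decomposition p gamma f fu,
        forall u : {set 'I_s}, 0 < gamma u -> @Fu_deriv p s u (fu u) (g u) &
        N = weighted_norm p gamma g].

Definition anchored_ball p s (gamma : {set 'I_s} -> R) : set (s.-tuple R -> R) :=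
  [set f | exists2 N : \bar R, is_anchored_norm p gamma f N & (N <= 1)%E].

(** The inclusion [emb] of F_{s,p,gamma} in the normed space L = L_q. *)
Record Lq_embedding p q s (gamma : {set 'I_s} -> R) (L : normedModType R)
    (emb : (s.-tuple R -> R) -> L) : Prop := {
  emb_linear : forall (a : R) (f g : s.-tuple R -> R),
    anchored_space p gamma f -> anchored_space p gamma g ->
    emb (fun x => a * f x + g x) = a *: emb f + emb g;
  emb_inj : forall f g : s.-tuple R -> R,
    anchored_space p gamma f -> anchored_space p gamma g ->
    emb f = emb g <-> {in @cube R s, f =1 g};
  emb_norm : forall (u : {set 'I_s}) (f : s.-tuple R -> R),
    0 < gamma u -> Fu_space p u f ->
    (`|emb f|%:E = Lp_norm q (fun t : #|u|.-tuple R => f (@pad s u t)))%E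
}.

(** A(f) = phi(f(x_1), ..., f(x_n)) with x_j in [0,1]^m. *)
Record algorithm (L : Type) m := Algorithm {
  alg_size : nat;
  alg_points : 'I_alg_size -> m.-tuple R;
  alg_points_cube : forall j, cube (alg_points j);
  alg_phi : alg_size.-tuple R -> L
}.

Definition alg_apply (L : Type) m (A : algorithm L m) (f : m.-tuple R -> R) : L :=
  @alg_phi L m A [tuple f (alg_points j) | j < alg_size A].

(** sup of ||S f - A f|| over the unit ball of F_{m,p,gamma}; possibly +oo.  It
    is an operator norm, i.e. ||S f - A f|| <= error * ||f|| for all f, only when
    S - A is positively homogeneous. *)
Definition worst_case_error p m (gamma : {set 'I_m} -> R) (L : normedModType R)
    (S A : (m.-tuple R -> R) -> L) : \bar R :=
  ereal_sup [set (`|S f - A f|%:E)%E | f in anchored_ball p gamma].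

Definition initial s k : {set 'I_s} := [set j : 'I_s | (j < k)%N]%SET.

(** (gamma_u) for u included in [k], as a family indexed by the subsets of [k]. *)
Definition restrict_weights s k (hks : (k <= s)%N) (gamma : {set 'I_s} -> R)
    (v : {set 'I_k}) : R :=
  gamma (widen_ord hks @: v)%SET.

(** A function of x_1, ..., x_k viewed as a function of x_1, ..., x_s. *)
Definition lift_fun s k (hks : (k <= s)%N) (h : k.-tuple R -> R) (x : s.-tuple R) : R :=
  h [tuple tnth x (widen_ord hks i) | i < k].

(** f_k(x_1, ..., x_k) = f(x_1, ..., x_k, 0, ..., 0) *)
Definition truncate s k (f : s.-tuple R -> R) (x : k.-tuple R) : R :=
  f [tuple nth 0 x i | i < s].

Definition truncation_property p s (gamma : {set 'I_s} -> R) (L : normedModType R)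
    (emb : (s.-tuple R -> R) -> L) (e : R) (k : nat) : Prop :=
  forall (f : s.-tuple R -> R) (fu : {set 'I_s} -> s.-tuple R -> R),
    is_anchored_decomposition p gamma f fu ->
    let tail := fun x =>
      \sum_(u : {set 'I_s} | (0 < gamma u) && ~~ (u \subset initial s k)) fu u x in
    forall N : \bar R, is_anchored_norm p gamma tail N ->
    (`|emb tail|%:E <= e%:E * N)%E.

(** [d] = dim^trnc(e), the least integer with the truncation property; it exists
    as the property holds for [s], where the sum is empty. *)
Definition is_trunc_dim p s (gamma : {set 'I_s} -> R) (L : normedModType R)
    (emb : (s.-tuple R -> R) -> L) (e : R) (d : nat) : Prop :=
  truncation_property p gamma emb e d /\
  forall j : nat, truncation_property p gamma emb e j -> (d <= j)%N.

(** (q/r + 1)^(1/q), with limiting value 1 for q = oo. *)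
Definition Lq_factor q (r : R) : R :=
  match q with
  | t%:E => (t / r + 1) `^ t^-1
  | _ => 1
  end.

End anchored_spaces.

(* Main.v *)
Require Import Defs.
From mathcomp Require Import all_boot all_order all_algebra.
From mathcomp Require Import all_classical all_reals all_analysis.
From mathcomp Require Import measurable_realfun ess_sup_inf.
From mathcomp Require Import ring.

(** Let [f] be in the unit ball, with components [f_u].  Restricting [f] to
    x_(k+1) = ... = x_s = 0 annihilates every component with [u] not included in
    [k], because such a component is an integral over a box with an empty side,
    and leaves the other components unchanged.  So [f] is the sum of a head, which
    is the lift of the truncated function [f_k], and a tail, the sum of the
    components with [u] not included in [k]; and the truncated algorithm has error

      |f - A(f_k)|  <=  |f_k - A(f_k)| + |tail|  <=  err_k * |f_k| + B * |tail|_F,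

    where [B] bounds the embedding of tails into L_q, and where homogeneity of [A]
    turns the supremum over the unit ball into the factor |f_k|.  The p-th powers
    of the two norms on the right add up to the p-th power of the norm of [f],
    which is at most 1, so Hoelder's inequality for two terms bounds the right-hand
    side by (err_k^p* + B^p* )^(1/p* ), read as a maximum for [p = 1]; for [p = +oo]
    both norms are at most 1 and the bound is err_k + B.  This is
    [trunc_error_bound], and the three bounds of the theorem differ only in the
    choice of [B].

    If the truncation property holds for some [d <= k], then [B = e] will do: the
    tail for [k] is also a tail for [d] ([truncation_property_partial_sum]).
    Without it, [B] comes from estimating the components one by one.  A component
    is the integral of its mixed derivative [g] over the box with corner [x], so
    Hoelder's inequality bounds it pointwise by |g|_p * (\prod_(j in u) x_j)^(1/p* )
    ([mixed_primitive_le]); taking L_q norms over the cube, where the monomial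
    factors, gives |f_u|_q <= |g|_p * (q/p* + 1)^(-|u|/q)
    ([Lq_norm_mixed_primitive]).  Summing over [u] with Hoelder's inequality gives
    the value of [B] for [p > 1] ([emb_partial_sum_le_hoelder]) and for [p = 1]
    ([emb_partial_sum_le_max]). *)

Set Implicit Arguments.
Unset Strict Implicit.
Unset Printing Implicit Defensive.

Import Order.TTheory GRing.Theory Num.Def Num.Theory.
Import numFieldNormedType.Exports.

Local Open Scope ring_scope.

(** * Integrals over the unit cube *)

Section cube_integrals.
Context {R : realType}.
Local Open Scope classical_set_scope.

Lemma integral_unit_itv (f : measurableTypeR R -> \bar R) :
  measurable_fun setT f -> (forall x, 0 <= f x)%E ->
  (\int[@unit_itv_measure R]_x f x =
   \int[@lebesgue_measure R]_(x in `[0%R, 1%R]) f x)%E.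
Proof.
move=> mf f0.
have mI : measurable (`[0%R, 1%R] : set (measurableTypeR R)) by exact: measurable_itv.
rewrite (@ge0_negligible_integral _ _ _ _ setT
  (~` (`[0%R, 1%R] : set (measurableTypeR R))))//.
- rewrite setTD setCK.
  by apply: eq_measure_integral => A mA AI; rewrite /= /unit_itv_measure /mrestr/= setIidl.
- exact: measurableC.
- by rewrite /= /unit_itv_measure /mrestr/= setICl measure0.
Qed.

Lemma continuous_powR_ge0 (a : R) : 0 < a ->
  {within `[0%R, 1%R], continuous (fun x : R => x `^ a)}.
Proof.
move=> a0; apply/continuous_within_itvP; first exact: ltr01.
split.
- move=> x; rewrite in_itv/= => /andP[x0 _].
  apply/differentiable_continuous/derivable1_diffP/derivable_powR.
  by rewrite in_itv/= x0.
- by rewrite powR0 ?gt_eqF//; exact: powR_cvg0.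
- apply: cvg_at_left_filter.
  suff : {for 1, continuous (fun x : R => x `^ a)} by [].
  apply/differentiable_continuous/derivable1_diffP/derivable_powR.
  by rewrite in_itv/= ltr01.
Qed.

(** [x `^ a] is [1] for negative [x], so the antiderivative is not differentiable at
    [0]; the fundamental theorem of calculus is used in its form for primitives
    that are merely one-sided continuous at the end points. *)
Lemma integral_unit_powR (a : R) : 0 < a ->
  (\int[@unit_itv_measure R]_x (x `^ a)%:E = ((a + 1)^-1)%:E)%E.
Proof.
move=> a0; have a1 : 0 < a + 1 by rewrite addr_gt0.
rewrite integral_unit_itv; last 2 first.
- by apply/measurable_EFinP; exact: measurable_powR.
- by move=> x; rewrite lee_fin powR_ge0.
rewrite (@continuous_FTC2 _ _ (fun x => (a + 1)^-1 * x `^ (a + 1)))//.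
- by rewrite powR1 powR0 ?gt_eqF// mulr1 mulr0 sube0.
- exact: continuous_powR_ge0.
- have /continuous_within_itvP := continuous_powR_ge0 a1.
  move=> /(_ ltr01) [_ c0 c1].
  split.
  + move=> x; rewrite in_itv/= => /andP[x0 _].
    apply: derivableM => //.
    by apply: derivable_powR; rewrite in_itv/= x0.
  + by apply: cvgM => //; exact: cvg_cst.
  + by apply: cvgM => //; exact: cvg_cst.
- move=> x; rewrite in_itv/= => /andP[x0 _].
  rewrite derive1E deriveM//; last by apply: derivable_powR; rewrite in_itv/= x0.
  rewrite derive_cst scaler0 addr0 -derive1E powR_derive1 ?in_itv/= ?x0//.
  by rewrite addrK /GRing.scale/= mulrA mulVf ?gt_eqF// mul1r.
Qed.

(** The cube measure is built by iterated products, so Tonelli's theorem factors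
    the integral of a product of univariate functions.  This one formula gives
    both the volume of a box and the integral of a monomial. *)
Lemma integral_cube_prod n (h : 'I_n -> measurableTypeR R -> R) (c : 'I_n -> R) :
  (forall i x, 0 <= h i x) -> (forall i, measurable_fun setT (h i)) ->
  (forall i, \int[@unit_itv_measure R]_x (h i x)%:E = (c i)%:E)%E ->
  (\int[cube_measure n]_t (\prod_(i < n) h i (tnth t i))%:E =
   (\prod_(i < n) c i)%:E)%E.
Proof.
have mprod m (h' : 'I_m -> measurableTypeR R -> R) :
    (forall i, measurable_fun setT (h' i)) ->
    measurable_fun setT (fun t : m.-tuple R => (\prod_(i < m) h' i (tnth t i))%:E).
  move=> mh; apply/measurable_EFinP; apply: measurable_prod => i _.
  by apply: (measurableT_comp (mh i)); exact: measurable_tnth.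
elim: n h c => [|n IHn] h c h0 mh hc.
  rewrite /= integral_dirac//.
    by rewrite !big_ord0 diracT mul1e.
  exact: mprod.
rewrite /= ge0_integral_distribution//=; last 2 first.
- exact: mprod.
- by move=> t; rewrite lee_fin prodr_ge0.
rewrite fubini_tonelli1//=; last 2 first.
- exact: (measurableT_comp (mprod _ _ mh) (@measurable_tcons R n)).
- by move=> t; rewrite lee_fin prodr_ge0.
rewrite /fubini_F/=.
transitivity (\int[@unit_itv_measure R]_x ((h ord0 x)%:E *
    (\prod_(i < n) c (lift ord0 i))%:E))%E.
  apply: eq_integral => x _.
  rewrite -(IHn (fun i => h (lift ord0 i)))//.
  rewrite -ge0_integralZl_EFin//.
  - apply: eq_integral => t _; rewrite big_ord_recl/= -EFinM; congr (_ * _)%:E.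
    by apply: eq_bigr => i _; rewrite /tcons tnthS.
  - by move=> t _; rewrite lee_fin prodr_ge0.
  - by apply: (mprod n (fun i => h (lift ord0 i))) => i; exact: mh.
have c0 i : 0 <= c i.
  by rewrite -lee_fin -hc; apply: integral_ge0 => x _; rewrite lee_fin.
rewrite ge0_integralZr//=.
- by rewrite hc big_ord_recl EFinM.
- by apply/measurable_EFinP.
- by move=> x _; rewrite lee_fin.
- by rewrite lee_fin prodr_ge0.
Qed.
End cube_integrals.

(** * Set integrals of functions in L_p *)

Lemma fine_hoelder_conjugate_EFin (R : realType) (r : R) : 1 < r ->
  0 < fine (hoelder_conjugate r%:E) /\
  r^-1 + (fine (hoelder_conjugate r%:E))^-1 = 1.
Proof.
move=> r1; have r0 : 0 < r by exact: lt_trans r1.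
have -> : fine (hoelder_conjugate r%:E) = r / (r - 1).
  by rewrite /hoelder_conjugate/= gt_eqF// inver subr_eq0 gt_eqF.
split; first by rewrite divr_gt0// subr_gt0.
by rewrite invf_div mulrBl mul1r divff ?gt_eqF// subrKC.
Qed.

Lemma fine_hoelder_conjugate_gt0 (R : realType) (p : \bar R) : (1 < p)%E ->
  0 < fine (hoelder_conjugate p).
Proof.
case: p => [r|_|//]; last by rewrite hoelder_conjugatey ltr01.
by rewrite lte_fin => /fine_hoelder_conjugate_EFin[].
Qed.

Section set_integral_bound.
Context d (T : measurableType d) (R : realType).
Local Open Scope ereal_scope.
Local Open Scope classical_set_scope.

(** The integral of a nonnegative function is a supremum over the simple functions
    below it, hence monotone without any measurability.  This spares proving that
    mixed primitives are measurable. *)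
Lemma le_integral_nonmeasurable (mu : {measure set T -> \bar R})
    (f1 f2 : T -> \bar R) :
  (forall x, 0 <= f1 x) -> (forall x, f1 x <= f2 x) ->
  \int[mu]_x f1 x <= \int[mu]_x f2 x.
Proof.
move=> f10 f12; have f20 x : 0 <= f2 x by exact: le_trans (f12 x).
rewrite !ge0_integralTE//; apply: le_ereal_sup => _ [h hf1 <-].
by exists h => // x; exact: le_trans (hf1 x) (f12 x).
Qed.

Variable mu : {finite_measure set T -> \bar R}.

Lemma Lfun_integrable_ge1 (p : \bar R) (g : T -> R) :
  1 <= p -> g \in Lfun mu p -> mu.-integrable setT (EFin \o g).
Proof.
move=> p1 gp; apply/Lfun1_integrable.
by apply: Lfun_subset gp => //; exact: fin_num_measure.
Qed.

(** Hoelder's inequality for [g] against the indicator of [A].  For [p = 1] the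
    conjugate exponent is infinite and [fine] sends it to [0]; the volume factor
    is then [mu A `^ 0 = 1], which is the correct bound, so that the three cases
    [p = 1], [1 < p < +oo] and [p = +oo] share one statement. *)
Lemma norm_Rintegral_set_le (p : \bar R) (g : T -> R) (A : set T) :
  1 <= p -> g \in Lfun mu p -> measurable A ->
  (`| (\int[mu]_(t in A) g t)%R |)%:E <=
    Lnorm mu p (EFin \o g) *
    ((fine (mu A) `^ (fine (hoelder_conjugate p))^-1)%R)%:E.
Proof.
move=> p1 gp mA.
have ig := Lfun_integrable_ge1 p1 gp.
have igA : mu.-integrable A (EFin \o g) by exact: integrableS ig.
have mg : measurable_fun setT g.
  by move: gp; rewrite inE => /andP[]; rewrite inE.
have muA : mu A = (fine (mu A))%:E by rewrite fineK// fin_num_measure.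
apply: (@le_trans _ _ (\int[mu]_x (`|(g \* \1_A)%R x|)%:E)).
  rewrite -abse_EFin /Rintegral fineK; last exact: integrable_fin_num.
  apply: le_trans (le_abse_integral _ mA (measurable_int _ igA)) _.
  rewrite integral_mkcond le_eqVlt; apply/orP; left; apply/eqP.
  apply: eq_integral => x _; rewrite patchE/= indicE.
  by case: ifPn => _; rewrite ?mulr1// mulr0 normr0.
case: p p1 gp => [r r1 gp|_ gp|//].
- move: r1; rewrite lee_fin le_eqVlt => /predU1P[r1|r1].
    subst r; rewrite hoelder_conjugate1/= invr0 powRr0 mule1 Lnorm1.
    apply: le_integral_nonmeasurable => x; rewrite lee_fin ?normr_ge0//=.
    by rewrite normrM ler_piMr// indicE; case: (_ \in _); rewrite ?normr1 ?normr0.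
  have r0 : (0 < r)%R by exact: lt_trans r1.
  have [s0 rs] := fine_hoelder_conjugate_EFin r1; set s := fine _ in s0 rs *.
  have := hoelder mu mg (measurable_indic mA) r0 s0 rs.
  rewrite Lnorm1 => /le_trans; apply; rewrite le_eqVlt; apply/orP; left.
  apply/eqP; congr (_ * _).
  rewrite unlock -poweR_EFin -muA; congr (_ `^ _).
  rewrite -[in RHS](setIT A) -integral_indic//; apply: eq_integral => x _ /=.
  by rewrite indicE; case: (_ \in _); rewrite ?normr1 ?normr0 ?powR1 ?powR0// gt_eqF.
- rewrite hoelder_conjugatey invr1 powRr1 ?fine_ge0// -muA.
  rewrite unlock; case: ifPn => [mu0|]; last first.
    rewrite -leNgt => muT; have muT0 : mu [set: T] = 0.
      by apply/eqP; rewrite eq_le muT measure_ge0.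
    rewrite mul0e (@ge0_negligible_integral _ _ _ _ setT setT)//.
      by rewrite setDv integral_set0.
    by apply/measurable_EFinP; apply: measurableT_comp => //; apply: measurable_funM.
  have /ess_supP := lexx (ess_sup mu (abse \o (EFin \o g))).
  set M := ess_sup _ _ => gM.
  have M0 : 0 <= M by apply: ess_sup_gee => //; apply: nearW => x /=; rewrite lee_fin.
  rewrite -[in mu A](setIT A) -integral_indic// -ge0_integralZl//.
    apply: ae_ge0_le_integral => //.
    - apply/measurable_EFinP; apply: measurableT_comp => //.
      by apply: measurable_funM.
    - by move=> x _; rewrite mule_ge0// lee_fin.
    - by apply: measurable_funeM; apply/measurable_EFinP.
    - apply: filterS gM => x /= gM _; rewrite normrM EFinM.
      by rewrite (@ger0_norm _ (\1_A x))// lee_wpmul2r// lee_fin.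
  by apply/measurable_EFinP.
Qed.

End set_integral_bound.

(** * The L_q norm of a mixed primitive *)

Section mixed_primitive_bound.
Context {R : realType}.
Local Open Scope classical_set_scope.

Definition corner_box m (y : 'I_m -> R) : set (m.-tuple R) :=
  [set t | forall i, 0 <= tnth t i < y i].

Lemma indic_corner_box m (y : 'I_m -> R) (t : m.-tuple R) :
  \1_(corner_box y) t = \prod_(i < m) \1_(`[0, y i[ : set R) (tnth t i) :> R.
Proof.
have [ty|] := pselect (corner_box y t).
  rewrite indicE mem_set// big1// => i _.
  by rewrite indicE mem_set//= in_itv/= ty.
move=> /[dup] nty /existsNP[i /negP nti]; rewrite indicE memNset//.
by rewrite (bigD1 i)//= indicE memNset ?mul0r//= in_itv/=; exact/negP.
Qed.

Lemma measurable_corner_box m (y : 'I_m -> R) : measurable (corner_box y).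
Proof.
have -> : corner_box y = \bigcap_(i in [set: 'I_m])
    ((fun t : m.-tuple R => tnth t i) @^-1` `[0, y i[).
  apply/seteqP; split => [t ty i _/=|t ty i].
    by rewrite in_itv/= ty.
  by have := ty i I; rewrite /= in_itv.
apply: fin_bigcap_measurable => // i _; rewrite -[X in measurable X]setTI.
exact: measurable_tnth.
Qed.

Lemma cube_measure_corner_box m (y : 'I_m -> R) : (forall i, 0 <= y i <= 1) ->
  cube_measure m (corner_box y) = (\prod_(i < m) y i)%:E.
Proof.
move=> y01.
rewrite -[in LHS](setIT (corner_box y)) -integral_indic//; last first.
  exact: measurable_corner_box.
under eq_integral do rewrite indic_corner_box.
apply: (@integral_cube_prod R m (fun i => \1_(`[0, y i[ : set R)) y).
- by move=> i x; rewrite indicE.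
- by move=> i; apply: measurable_indic; exact: measurable_itv.
- move=> i; rewrite integral_indic// ?setIT.
  have /andP[yi0 yi1] := y01 i.
  rewrite /= /unit_itv_measure /mrestr setIidl.
    rewrite lebesgue_measure_itv/= lte_fin.
    move: yi0; rewrite le_eqVlt => /predU1P[<-|->]; first by rewrite ltxx.
    by rewrite sube0.
  move=> x /=; rewrite !in_itv/= => /andP[-> xy]/=.
  by rewrite (le_trans (ltW xy)).
Qed.

Lemma powR_prod (I : finType) (F : I -> R) (a : R) : (forall i, 0 <= F i) ->
  (\prod_i F i) `^ a = \prod_i F i `^ a.
Proof.
move=> F0.
suff [] : (\prod_i F i) `^ a = \prod_i F i `^ a /\ 0 <= \prod_i F i by [].
apply: (big_ind2 (fun x y => x `^ a = y /\ 0 <= x)) => //.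
- by rewrite powR1.
- by move=> x1 x2 y1 y2 [<- x0] [<- y0]; rewrite powRM// mulr_ge0.
Qed.

Lemma integral_cube_powR m (a : R) : 0 <= a ->
  (\int[cube_measure m]_t (\prod_(i < m) tnth t i `^ a)%:E =
   ((a + 1)^-1 ^+ m)%:E)%E.
Proof.
move=> a0; rewrite (@integral_cube_prod R m (fun _ x => x `^ a)
  (fun _ => (a + 1)^-1)); last first.
(* The exponent [0] occurs for [p = 1], where 1/p* = 0. *)
- move=> _; move: a0; rewrite le_eqVlt => /predU1P[<-|]; last first.
    exact: integral_unit_powR.
  under eq_integral do rewrite powRr0.
  rewrite integral_cst// add0r invr1 mul1e; exact: unit_itv_measure_setT.
- by move=> _; exact: measurable_powR.
- by move=> _ x; exact: powR_ge0.
- by rewrite prodr_const card_ord.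
Qed.

(** The pointwise estimate behind everything: the box with corner [x] has volume
    the product of the coordinates of [x] with index in [u], and Hoelder's
    inequality raises it to the power 1/p*. *)
Lemma mixed_primitive_le (p : \bar R) s (u : {set 'I_s})
    (g : #|u|.-tuple R -> R) (x : s.-tuple R) :
  (1 <= p)%E -> Lp_fun p g -> cube x ->
  (`|mixed_primitive g x|%:E <= Lp_norm p g *
     (\prod_(i < #|u|)
        tnth x (enum_val i) `^ (fine (hoelder_conjugate p))^-1)%:E)%E.
Proof.
move=> p1 gp x01.
have := @norm_Rintegral_set_le _ _ R (cube_measure #|u|) p g _ p1 gp
  (measurable_corner_box (fun i => tnth x (enum_val i))).
move=> /le_trans; apply; rewrite -powR_prod; last first.
  by move=> i; have /andP[] := x01 (enum_val i).
have := cube_measure_corner_box (fun i => x01 (enum_val i)).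
by move=> /= ->.
Qed.

Lemma tnth_pad s (u : {set 'I_s}) (t : #|u|.-tuple R) (i : 'I_#|u|) :
  tnth (pad t) (enum_val i) = tnth t i.
Proof.
rewrite tnth_mktuple (tnth_nth 0) /enum_val.
by rewrite index_uniq// ?enum_uniq// -cardE.
Qed.

Lemma Lq_factor_gt0 (q : \bar R) (r : R) : (1 <= q)%E -> 0 <= r ->
  0 < Lq_factor q r.
Proof.
case: q => [t t1 r0|_ _|//] /=; last exact: ltr01.
by rewrite powR_gt0// ltr_wpDl// divr_ge0// (le_trans ler01).
Qed.

Lemma fine_hoelder_conjugate_ge0 (p : \bar R) : (1 <= p)%E ->
  0 <= fine (hoelder_conjugate p).
Proof. by move=> /hoelder_conj_ge1 h; rewrite fine_ge0// (le_trans _ h). Qed.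

(** Integrating the q-th power of the pointwise estimate gives one factor
    1 / (q / p* + 1) per coordinate.  The function is made to vanish off the cube so
    that the estimate holds at every point, and not only almost everywhere, as
    monotonicity of the integral without measurability requires. *)
Lemma Lq_norm_mixed_primitive (p q : \bar R) s (u : {set 'I_s})
    (g : #|u|.-tuple R -> R) (f : s.-tuple R -> R) :
  (1 <= p)%E -> (1 <= q)%E -> Lp_fun p g ->
  (forall x, f x = if `[< cube x >] then mixed_primitive g x else 0) ->
  (Lp_norm q (fun t => f (@pad R s u t)) <= Lp_norm p g *
    (Lq_factor q (fine (hoelder_conjugate p)) ^- #|u|)%:E)%E.
Proof.
move=> p1 q1 gp fE.
set ps := fine _; have ps0 : 0 <= ps by exact: fine_hoelder_conjugate_ge0.
have [C0 CE] : 0 <= fine (Lp_norm p g) /\ Lp_norm p g = (fine (Lp_norm p g))%:E.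
  split; first by rewrite fine_ge0// Lnorm_ge0.
  rewrite fineK// ge0_fin_numE ?Lnorm_ge0//.
  by move: gp; rewrite /Lp_fun inE => /andP[_]; rewrite inE.
move: (fine _) C0 CE => C C0 CE; rewrite CE -EFinM.
have fle t : `|f (@pad R s u t)| <= C * \prod_(i < #|u|) tnth t i `^ ps^-1.
  rewrite fE; case: asboolP => [t01|_]; last first.
    by rewrite normr0 mulr_ge0// prodr_ge0// => i _; exact: powR_ge0.
  rewrite -lee_fin EFinM -CE.
  apply: le_trans (mixed_primitive_le p1 gp t01) _.
  by under eq_bigr do rewrite tnth_pad.
have fle1 t : `|f (@pad R s u t)| <= C.
  have [t01|nt01] := pselect (cube (@pad R s u t)); last first.
    by rewrite fE; case: asboolP => // _; rewrite normr0.
  apply: le_trans (fle t) _; rewrite ler_piMr//.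
  apply: Num.Theory.prodr_ile1 => i _; rewrite powR_ge0/= -tnth_pad.
  have /andP[ti0 ti1] := t01 (enum_val i).
  by rewrite -[leRHS](congr1 (@^~ ps^-1) (powR1 R)) ge0_ler_powR// ?invr_ge0// nnegrE.
rewrite /Lp_norm unlock; case: q q1 => [r r1|_|//].
- have r0 : 0 < r by apply: lt_le_trans ltr01 _; rewrite -lee_fin.
  have rps0 : 0 <= r / ps by rewrite divr_ge0// ltW.
  apply: (@le_trans _ _ ((\int[cube_measure #|u|]_t
      ((C `^ r)%:E * (\prod_(i < #|u|) tnth t i `^ (r / ps))%:E)) `^ r^-1)%E).
    rewrite gt0_ler_poweR// ?invr_ge0 ?(ltW r0)//.
    - rewrite in_itv/= leey andbT; apply: integral_ge0 => t _.
      by rewrite lee_fin powR_ge0.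
    - rewrite in_itv/= leey andbT; apply: integral_ge0 => t _.
      by rewrite -EFinM lee_fin mulr_ge0 ?powR_ge0// prodr_ge0// => i _; exact: powR_ge0.
    - apply: le_integral_nonmeasurable => t; first exact: poweR_ge0.
      rewrite /= -EFinM lee_fin; apply: (@le_trans _ _
        ((C * \prod_(i < #|u|) tnth t i `^ ps^-1) `^ r)).
        by rewrite ge0_ler_powR ?nnegrE// ?(ltW r0)// (le_trans _ (fle t)).
      rewrite powRM//; last by rewrite prodr_ge0// => i _; exact: powR_ge0.
      rewrite powR_prod; last by move=> i; exact: powR_ge0.
      by under eq_bigr do rewrite -powRrM mulrC.
  rewrite ge0_integralZl_EFin ?powR_ge0//; last 2 first.
  - by move=> t _; rewrite lee_fin prodr_ge0// => i _; exact: powR_ge0.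
  - apply/measurable_EFinP; apply: measurable_prod => i _.
    apply: (measurableT_comp (measurable_powR _)); exact: measurable_tnth.
  rewrite integral_cube_powR// -EFinM poweR_EFin lee_fin.
  set n := #|u|; rewrite /Lq_factor; set a := r / ps + 1.
  have a0 : 0 <= a by rewrite addr_ge0.
  suff -> : (C `^ r * a^-1 ^+ n) `^ r^-1 = C / (a `^ r^-1) ^+ n by [].
  rewrite powRM ?powR_ge0 ?exprn_ge0 ?invr_ge0//.
  rewrite -powRrM divff ?gt_eqF// powRr1//; congr (_ * _).
  rewrite -(powR_mulrn n (powR_ge0 a r^-1)) -powRN.
  have an : 0 <= a^-1 by rewrite invr_ge0.
  rewrite -(powR_mulrn n an) -(powR_inv1 a0).
  by rewrite -!powRrM; congr (_ `^ _); ring.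
- case: ifPn => // _; last first.
    by rewrite lee_fin mulr_ge0// invr_ge0 exprn_ge0.
  by apply/ess_supP; apply: nearW => t /=; rewrite expr1n invr1 mulr1 lee_fin.
Qed.

End mixed_primitive_bound.

(** * Classes of mixed derivatives *)

Section derivative_classes.
Context {R : realType}.
Implicit Types (p q : \bar R).

Lemma Lp_norm_fine p n (g : n.-tuple R -> R) : Lp_fun p g ->
  Lp_norm p g = (fine (Lp_norm p g))%:E.
Proof.
move=> gp; rewrite fineK// ge0_fin_numE ?Lnorm_ge0//.
by move: gp; rewrite /Lp_fun inE => /andP[_]; rewrite inE.
Qed.

Lemma Lp_norm_ge0 p n (g : n.-tuple R -> R) : 0 <= fine (Lp_norm p g).
Proof. by rewrite fine_ge0// Lnorm_ge0. Qed.

Lemma Lp_fun0 p n : (1 <= p)%E -> Lp_fun p (fun _ : n.-tuple R => 0).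
Proof.
move=> p1; rewrite /Lp_fun inE; apply/andP; split; rewrite inE//=.
exact: (finite_norm_cst0 (cube_measure n) p1).
Qed.

Lemma Lp_norm0 p n : (1 <= p)%E -> Lp_norm p (fun _ : n.-tuple R => 0) = 0%E.
Proof.
by move=> p1; rewrite /Lp_norm [LHS]Lnorm0// gt_eqF// (lt_le_trans _ p1).
Qed.

Lemma Lp_funZ p n (c : R) (g : n.-tuple R -> R) : (1 <= p)%E ->
  Lp_fun p g -> Lp_fun p (fun t => c * g t).
Proof.
move=> p1 gp; have [_ +] := Lfun_submod_closed (cube_measure n) p1.
move=> /(_ c g (fun=> 0) gp (Lp_fun0 n p1)); rewrite /Lp_fun => h.
by rewrite (_ : (fun t => c * g t) = c *: g + (fun=> 0))//; apply/funext => t;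
  rewrite -[RHS]/(c * g t + 0) addr0.
Qed.

Lemma Lp_normZ p n (c : R) (g : n.-tuple R -> R) : (1 <= p)%E ->
  Lp_fun p g -> Lp_norm p (fun t => c * g t) = (`|c|%:E * Lp_norm p g)%E.
Proof. by move=> p1 gp; exact: (LnormZ (Lfun_Sub p1 gp) c). Qed.

Lemma tensor_deriv_measurable p n (h : n.-tuple R -> R) :
  tensor_deriv p h -> measurable_fun setT h.
Proof.
move=> [m [c [k [hk ->]]]]; apply: measurable_sum => i.
apply: measurable_funM => //; apply: measurable_prod => j _.
have [f [_ _ kij _]] := hk i j.
have mk : measurable_fun setT (k i j).
  by move: kij; rewrite inE => /andP[]; rewrite inE.
by apply: (measurableT_comp mk); exact: measurable_tnth.
Qed.

Lemma completed_deriv0 p n : (1 <= p)%E ->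
  completed_deriv p (fun _ : n.-tuple R => 0).
Proof.
move=> p1; split; first exact: Lp_fun0.
move=> e e0; exists (fun=> 0).
  exists 0%N, (fun=> 0), (fun _ _ _ => 0); split => [[]//|].
  by apply/funext => t; rewrite big_ord0.
under [X in Lp_norm p X]eq_fun do rewrite subr0.
by rewrite Lp_norm0.
Qed.

(** Scaling the L_p norm of the difference [g - h] requires that it belongs to
    L_p: its norm is small, hence finite, and it is measurable because elements
    of [tensor_deriv] are. *)
Lemma completed_derivZ p n (c : R) (g : n.-tuple R -> R) : (1 <= p)%E ->
  0 < c -> completed_deriv p g -> completed_deriv p (fun t => c * g t).
Proof.
move=> p1 c0 [gp gh]; split; first exact: Lp_funZ.
move=> e e0; have [h hT ghe] := gh (e / c) (divr_gt0 e0 c0).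
exists (fun t => c * h t).
  have [m [a [k [hk ->]]]] := hT.
  exists m, (fun i => c * a i), k; split => //.
  by apply/funext => t; rewrite mulr_sumr; apply: eq_bigr => i _; rewrite mulrA.
under [X in Lp_norm p X]eq_fun do rewrite -mulrBr.
rewrite Lp_normZ//.
  by rewrite gtr0_norm// muleC -lte_pdivlMr// -EFinM.
rewrite /Lp_fun inE; apply/andP; split; rewrite inE/=.
  apply: measurable_funB; last exact: tensor_deriv_measurable hT.
  by move: gp; rewrite /Lp_fun inE => /andP[]; rewrite inE.
by rewrite /finite_norm; apply: lt_trans ghe _; rewrite ltry.
Qed.

End derivative_classes.

(** * Components and partial sums of an anchored decomposition *)

Section anchored_components.
Context {R : realType}.
Variables (p : \bar R) (p1 : (1 <= p)%E) (s : nat).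
Implicit Types (u : {set 'I_s}) (P : pred {set 'I_s}).

(** Selecting the components with index in [P] and replacing the others by [0],
    rather than dropping them, keeps a family indexed by all subsets, which is
    what decompositions and weighted norms are about. *)
Definition restrict_fun P (fu : {set 'I_s} -> s.-tuple R -> R) :=
  fun u x => if P u then fu u x else 0.

Definition restrict_deriv P (g : forall u, #|u|.-tuple R -> R) :=
  fun u t => if P u then g u t else 0.

Arguments restrict_deriv : clear implicits.

Lemma measurable_anchored_box u (x : s.-tuple R) :
  measurable ([set t | forall i : 'I_#|u|, 0 <= tnth t i < tnth x (enum_val i)]%classic
    : set (#|u|.-tuple R)).
Proof. exact: measurable_corner_box. Qed.

Lemma mixed_primitive0 u (x : s.-tuple R) :
  mixed_primitive (fun _ : #|u|.-tuple R => 0) x = 0.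
Proof.
rewrite /mixed_primitive /Rintegral integral0_eq//.
Qed.

Lemma mixed_primitiveZ u (c : R) (g : #|u|.-tuple R -> R) (x : s.-tuple R) :
  Lp_fun p g ->
  mixed_primitive (fun t => c * g t) x = c * mixed_primitive g x.
Proof.
move=> gp; rewrite /mixed_primitive RintegralZl//.
  exact: measurable_anchored_box.
apply: (@integrableS _ _ _ _ setT) => //; first exact: measurable_anchored_box.
exact: Lfun_integrable_ge1 gp.
Qed.

(** The domain of integration is empty as soon as one of its sides is. *)
Lemma mixed_primitive_anchored u (g : #|u|.-tuple R -> R) (x : s.-tuple R) j :
  j \in u -> tnth x j <= 0 -> mixed_primitive g x = 0.
Proof.
move=> ju xj; rewrite /mixed_primitive.
rewrite (_ : [set t | _]%classic = set0); first by rewrite Rintegral_set0.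
apply/seteqP; split => // t /(_ (enum_rank_in ju j)).
rewrite enum_rankK_in// => /andP[t0 tx].
by have := le_lt_trans t0 (lt_le_trans tx xj); rewrite ltxx.
Qed.

Lemma mixed_primitive_eq u (g : #|u|.-tuple R -> R) (x y : s.-tuple R) :
  {in u, forall j, tnth x j = tnth y j} ->
  mixed_primitive g x = mixed_primitive g y.
Proof.
move=> xy; rewrite /mixed_primitive; congr Rintegral.
by apply/seteqP; split => t /= + i => /(_ i); rewrite xy//; exact: enum_valP.
Qed.

Lemma Fu_deriv0 u : Fu_deriv p (fun=> 0) (fun _ : #|u|.-tuple R => 0).
Proof.
split; first exact: completed_deriv0.
by move=> x _; rewrite mixed_primitive0.
Qed.

Lemma Fu_derivZ u (c : R) f (g : #|u|.-tuple R -> R) : 0 < c ->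
  Fu_deriv p f g -> Fu_deriv p (fun x => c * f x) (fun t => c * g t).
Proof.
move=> c0 [gc fg]; split; first exact: completed_derivZ.
by move=> x x01; rewrite fg// mixed_primitiveZ//; case: gc.
Qed.

Lemma Fu_deriv_restrict P u fu (g : forall u, #|u|.-tuple R -> R) :
  Fu_deriv p (fu u) (g u) ->
  Fu_deriv p (restrict_fun P fu u) (restrict_deriv P g u).
Proof.
move=> h; rewrite /restrict_fun /restrict_deriv.
by case: (P u) => //; exact: Fu_deriv0.
Qed.

Variable gamma : {set 'I_s} -> R.
Variables (fu : {set 'I_s} -> s.-tuple R -> R)
          (g : forall u, #|u|.-tuple R -> R).
Arguments g : clear implicits.
Hypothesis fug : forall u, 0 < gamma u -> Fu_deriv p (fu u) (g u).

Definition partial_sum P (x : s.-tuple R) :=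
  \sum_(u : {set 'I_s} | (0 < gamma u) && P u) fu u x.

Lemma partial_sum_decomposition P :
  is_anchored_decomposition p gamma (partial_sum P) (restrict_fun P fu).
Proof.
split => [u u0|x _].
  by exists (restrict_deriv P g u); exact/Fu_deriv_restrict/fug.
by rewrite /partial_sum big_mkcondr.
Qed.

Lemma partial_sum_norm P : is_anchored_norm p gamma (partial_sum P)
  (weighted_norm p gamma (restrict_deriv P g)).
Proof.
exists (restrict_fun P fu), (restrict_deriv P g); split => //.
  exact: partial_sum_decomposition.
by move=> u u0; exact/Fu_deriv_restrict/fug.
Qed.

Lemma partial_sum_anchored P : anchored_space p gamma (partial_sum P).
Proof. by exists (restrict_fun P fu); exact: partial_sum_decomposition. Qed.

End anchored_components.
Arguments restrict_deriv {R s} P g u _.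

(** * The embedding into L_q *)

Section embedding.
Context {R : realType}.
Variables (p q : \bar R) (p1 : (1 <= p)%E) (q1 : (1 <= q)%E) (s : nat).
Variable gamma : {set 'I_s} -> R.
Variables (L : normedModType R) (emb : (s.-tuple R -> R) -> L).
Hypothesis hemb : Lq_embedding p q gamma emb.
Implicit Types (u : {set 'I_s}) (P : pred {set 'I_s}).

Lemma Fu_anchored u f (g : #|u|.-tuple R -> R) :
  0 < gamma u -> Fu_deriv p f g -> anchored_space p gamma f.
Proof.
move=> u0 fg; exists (fun v x => if v == u then f x else 0); split.
  move=> v v0; case: eqP => [->|_]; first by exists g.
  by exists (fun=> 0); exact: Fu_deriv0.
move=> x _; rewrite (bigD1 u)//= eqxx big1 ?addr0// => v /andP[_ /negPf ->//].
Qed.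

Lemma emb_eq f h : anchored_space p gamma f -> anchored_space p gamma h ->
  (forall x, cube x -> f x = h x) -> emb f = emb h.
Proof.
by move=> fp hp fh; apply/(emb_inj hemb fp hp) => x /set_mem; exact: fh.
Qed.

Lemma anchored_space_eq f h : anchored_space p gamma f ->
  (forall x, cube x -> f x = h x) -> anchored_space p gamma h.
Proof.
move=> [fu [hfu ffu]] fh; exists fu; split => // x xc.
by rewrite -fh ?ffu//; exact: set_mem.
Qed.

(** The embedding sees only the values on the cube, so [f] may be replaced by the
    mixed primitive of [g] extended by [0], to which the L_q estimate applies. *)
Lemma emb_Fu_le u f (g : #|u|.-tuple R -> R) : 0 < gamma u ->
  Fu_deriv p f g ->
  `|emb f| <= fine (Lp_norm p g) *
     Lq_factor q (fine (hoelder_conjugate p)) ^- #|u|.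
Proof.
move=> u0 fg; have [[gp _] fE] := fg.
pose f' := fun x => if `[< cube x >] then mixed_primitive g x else 0.
have f'E x : cube x -> mixed_primitive g x = f' x.
  by rewrite /f' => xc; case: asboolP.
have f'g : Fu_deriv p f' g.
  by case: fg => gc _; split => // x /set_mem xc; rewrite f'E.
rewrite (@emb_eq f f'); last 3 first.
- exact: Fu_anchored fg.
- exact: Fu_anchored f'g.
- by move=> x xc; rewrite -f'E// fE// mem_set.
rewrite -lee_fin (emb_norm hemb u0); last by exists g.
rewrite EFinM -Lp_norm_fine//.
exact: Lq_norm_mixed_primitive.
Qed.

Lemma anchored_space0 : anchored_space p gamma (fun=> 0 : R).
Proof.
exists (fun _ _ => 0); split => [u _|x _]; last by rewrite big1.
by exists (fun=> 0); exact: Fu_deriv0.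
Qed.
Lemma emb0 : emb (fun=> 0) = 0.
Proof.
have z := anchored_space0.
have := emb_linear hemb 1 z z; rewrite scale1r.
under [X in emb X = _]eq_fun do rewrite mulr0 addr0.
by move=> /(congr1 (fun x => x - emb (fun=> 0))); rewrite subrr addrK.
Qed.

Lemma embD f h : anchored_space p gamma f -> anchored_space p gamma h ->
  emb (fun x => f x + h x) = emb f + emb h.
Proof.
move=> fp hp; have := emb_linear hemb 1 fp hp; rewrite scale1r => <-.
by congr emb; apply/funext => x; rewrite mul1r.
Qed.

Lemma embZ c f : anchored_space p gamma f ->
  emb (fun x => c * f x) = c *: emb f.
Proof.
have z := anchored_space0.
move=> fp; have := emb_linear hemb c fp z; rewrite emb0 addr0 => <-.
by congr emb; apply/funext => x; rewrite addr0.
Qed.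

Variables (fu : {set 'I_s} -> s.-tuple R -> R)
          (g : forall u, #|u|.-tuple R -> R).
Arguments g : clear implicits.
Hypothesis fug : forall u, 0 < gamma u -> Fu_deriv p (fu u) (g u).

(** Linearity of the embedding is only available inside the anchored space, so
    the components are split off one by one, each partial sum left over being
    again an element of the space. *)
Lemma emb_partial_sum P :
  emb (partial_sum gamma fu P) = \sum_(u | (0 < gamma u) && P u) emb (fu u).
Proof.
have [n] := ubnP #|[pred u | (0 < gamma u) && P u]|.
elim: n P => // n IHn P; rewrite ltnS => leP.
case: (pickP [pred u | (0 < gamma u) && P u]) => [u /= uP|noP]; last first.
  rewrite big_pred0// -emb0; congr emb; apply/funext => x.
  by rewrite /partial_sum big_pred0.
rewrite (bigD1 u)//=.
have -> : partial_sum gamma fu P =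
    (fun x => fu u x + partial_sum gamma fu (fun v => P v && (v != u)) x).
  apply/funext => x; rewrite /partial_sum (bigD1 u)//=; congr (_ + _).
  by apply: eq_bigl => v; rewrite andbA.
have /andP[u0 _] := uP.
rewrite embD; last 2 first.
- exact: Fu_anchored (fug u0).
- exact: partial_sum_anchored fug _.
congr (_ + _); rewrite IHn; first by apply: eq_bigl => v; rewrite andbA.
apply: leq_trans leP; apply: proper_card; apply/properP; split.
  by apply/fintype.subsetP => v; rewrite !inE => /and3P[-> ->].
by exists u; rewrite !inE// eqxx !andbF.
Qed.

End embedding.

(** * Weighted norms *)

Section weighted_norms.
Context {R : realType}.
Variables (s : nat) (gamma : {set 'I_s} -> R).
Hypothesis gamma_ge0 : forall u, 0 <= gamma u.
Implicit Type g : forall u : {set 'I_s}, #|u|.-tuple R -> R.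

Definition scaled_norm (p : \bar R) g (u : {set 'I_s}) : R :=
  (gamma u)^-1 * fine (Lp_norm p (g u)).

Lemma scaled_norm_ge0 p g u : 0 <= scaled_norm p g u.
Proof. by rewrite mulr_ge0 ?invr_ge0 ?Lp_norm_ge0. Qed.

Lemma weighted_norm_fin (r : R) g : 1 <= r ->
  (forall u, 0 < gamma u -> Lp_fun r%:E (g u)) ->
  weighted_norm r%:E gamma g =
  ((\sum_(u | 0 < gamma u) scaled_norm r%:E g u `^ r) `^ r^-1)%:E.
Proof.
move=> r1 gp; rewrite /weighted_norm -poweR_EFin -sumEFin; congr (_ `^ _)%E.
apply: eq_bigr => u u0; rewrite [Lp_norm _ _]Lp_norm_fine; last exact: gp.
rewrite poweR_EFin -EFinM /scaled_norm powRM ?invr_ge0 ?Lp_norm_ge0//.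
by rewrite -[(gamma u)^-1]powR_inv1// -powRrM mulN1r.
Qed.

(** For [p = +oo] the maximum is never computed: only upper bounds of it matter. *)
Lemma weighted_norm_infty_le g (B : R) : 0 <= B ->
  (forall u, 0 < gamma u -> Lp_fun +oo%E (g u)) ->
  (weighted_norm +oo%E gamma g <= B%:E)%E <->
  (forall u, 0 < gamma u -> scaled_norm +oo%E g u <= B).
Proof.
move=> B0 gp; rewrite /weighted_norm; split=> [h u u0|h].
  rewrite -lee_fin /scaled_norm EFinM -Lp_norm_fine; last exact: gp.
  by apply: le_trans h; rewrite (bigD1 u)//= le_max lexx.
apply: (big_ind (fun x => (x <= B%:E)%E)) => //.
- by move=> x y xB yB; rewrite ge_max xB.
- move=> u u0; rewrite [Lp_norm _ _]Lp_norm_fine; last exact: gp.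
  rewrite -EFinM lee_fin.
  exact: h.
Qed.

Lemma scaled_norm_restrict (p : \bar R) g (P : pred {set 'I_s}) u : (1 <= p)%E ->
  scaled_norm p (restrict_deriv P g) u =
  if P u then scaled_norm p g u else 0.
Proof.
move=> p1; rewrite /scaled_norm /restrict_deriv; case: (P u) => //.
by rewrite Lp_norm0// mulr0.
Qed.

Lemma weighted_norm_restrict_fin (r : R) g (P : pred {set 'I_s}) : 1 <= r ->
  (forall u, 0 < gamma u -> Lp_fun r%:E (g u)) ->
  weighted_norm r%:E gamma (restrict_deriv P g) =
  ((\sum_(u | (0 < gamma u) && P u) scaled_norm r%:E g u `^ r) `^ r^-1)%:E.
Proof.
move=> r1 gp.
have gp' u : 0 < gamma u -> Lp_fun r%:E (restrict_deriv P g u).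
  by move=> u0; rewrite /restrict_deriv; case: (P u); [exact: gp|exact: Lp_fun0].
rewrite (weighted_norm_fin r1 gp').
congr (_ `^ _)%:E; rewrite big_mkcondr; apply: eq_bigr => u _.
rewrite scaled_norm_restrict//; case: (P u) => //.
by rewrite powR0// gt_eqF// (lt_le_trans ltr01).
Qed.

End weighted_norms.

(** * Truncation to the first k coordinates *)

Section truncation.
Context {R : realType}.
Variables (p : \bar R) (p1 : (1 <= p)%E) (s k : nat) (hks : (k <= s)%N).

Definition widen_set (v : {set 'I_k}) : {set 'I_s} := (widen_ord hks @: v)%SET.

Lemma widen_ord_inj : injective (widen_ord hks).
Proof. by move=> i j /(congr1 val)/= /val_inj. Qed.

Lemma card_widen_set (v : {set 'I_k}) : #|v| = #|widen_set v|.
Proof. by rewrite card_imset//; exact: widen_ord_inj. Qed.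

Lemma sorted_enum n (A : {set 'I_n}) : sorted ltn (map val (enum A)).
Proof.
apply: (subseq_sorted ltn_trans) (iota_ltn_sorted 0 n).
rewrite -val_enum_ord; apply: map_subseq; rewrite [enum A]/(enum_mem _) enumT.
exact: filter_subseq.
Qed.

(** The coordinates of a point of R^|u| are attached to the elements of [u] through
    [enum u]; widening the ordinals is increasing, so it respects that
    numbering, and the derivatives of a component with index in [k] can be read
    with respect to either numbering. *)
Lemma enum_widen_set (v : {set 'I_k}) : enum (widen_set v) = map (widen_ord hks) (enum v).
Proof.
apply: (inj_map val_inj); apply: (irr_sorted_eq ltn_trans ltnn).
- exact: sorted_enum.
- by rewrite -map_comp (eq_map (g := val))//; exact: sorted_enum.
move=> j; apply/mapP/mapP => -[i].
  rewrite mem_enum => /imsetP[l lv ->] ->; exists (widen_ord hks l) => //.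
  by rewrite map_f// mem_enum.
move=> /mapP[l]; rewrite mem_enum => lv -> ->; exists (widen_ord hks l) => //.
by rewrite mem_enum imset_f.
Qed.

Lemma enum_val_widen (v : {set 'I_k}) (i : 'I_#|v|) :
  enum_val (cast_ord (card_widen_set v) i) = widen_ord hks (enum_val i).
Proof.
rewrite /enum_val; set x0 := enum_default _.
rewrite enum_widen_set (nth_map (enum_default i)) -?cardE//.
exact: (ltn_ord i).
Qed.

Lemma widen_set_sub (v : {set 'I_k}) : widen_set v \subset initial s k.
Proof.
by apply/fintype.subsetP => _ /imsetP[i _ ->]; rewrite inE /= ltn_ord.
Qed.

Lemma widen_setK (v : {set 'I_k}) : (widen_ord hks @^-1: widen_set v)%SET = v.
Proof.
apply/setP => j; rewrite inE mem_imset//; exact: widen_ord_inj.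
Qed.

Lemma sub_initial_widen (u : {set 'I_s}) : u \subset initial s k ->
  widen_set (widen_ord hks @^-1: u)%SET = u.
Proof.
move=> /fintype.subsetP uk; apply/setP => j; apply/imsetP/idP => [[i]|ju].
  by rewrite inE => iu ->.
have := uk _ ju; rewrite inE => jk; exists (Ordinal jk); last exact: val_inj.
by rewrite inE; congr (_ \in u): ju; exact: val_inj.
Qed.

Lemma sum_sub_initial (V : nmodType) (P : pred {set 'I_s}) (F : {set 'I_s} -> V) :
  \sum_(u | P u && (u \subset initial s k)) F u =
  \sum_(v | P (widen_set v)) F (widen_set v).
Proof.
rewrite (reindex_onto widen_set (fun u => (widen_ord hks @^-1: u)%SET)).
  by apply: eq_bigl => v; rewrite widen_set_sub andbT widen_setK eqxx andbT.
by move=> u /andP[_]; exact: sub_initial_widen.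
Qed.

(** [v] and [widen_set v] have the same cardinality only propositionally; casting
    the points along that equality changes nothing. *)
Lemma completed_deriv_tcast n m (e : n = m) (g : m.-tuple R -> R) :
  completed_deriv p g -> completed_deriv p (fun t => g (tcast e t)).
Proof. by case: m / e g => g; under eq_fun do rewrite tcast_id. Qed.

Lemma Lp_norm_tcast n m (e : n = m) (g : m.-tuple R -> R) :
  Lp_norm p (fun t => g (tcast e t)) = Lp_norm p g.
Proof. by case: m / e g => g; under eq_fun do rewrite tcast_id. Qed.

Lemma Rintegral_corner_box_tcast n m (e : n = m) (g : m.-tuple R -> R)
    (a : 'I_n -> R) (b : 'I_m -> R) : (forall i, a i = b (cast_ord e i)) ->
  Rintegral (cube_measure n) (corner_box a) (fun t => g (tcast e t)) =
  Rintegral (cube_measure m) (corner_box b) g.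
Proof.
case: m / e g b => g b ab; under eq_fun do rewrite tcast_id.
by congr (Rintegral _ (corner_box _) _); apply/funext => i; rewrite ab cast_ord_id.
Qed.

Definition zero_pad (x : k.-tuple R) : s.-tuple R := [tuple nth 0 x i | i < s].

Lemma tnth_zero_pad_widen x j : tnth (zero_pad x) (widen_ord hks j) = tnth x j.
Proof. by rewrite tnth_mktuple /= (tnth_nth 0). Qed.

Lemma tnth_zero_pad0 x j : j \notin initial s k -> tnth (zero_pad x) j = 0.
Proof. by rewrite inE -leqNgt => kj; rewrite tnth_mktuple nth_default ?size_tuple. Qed.

Lemma cube_zero_pad x : cube x -> cube (zero_pad x).
Proof.
move=> x01 j; have [jk|jk] := boolP (j \in initial s k); last first.
  by rewrite tnth_zero_pad0// lexx ler01.
rewrite inE in jk.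
rewrite (_ : j = widen_ord hks (Ordinal jk)); last exact: val_inj.
by rewrite tnth_zero_pad_widen.
Qed.

Definition truncate_deriv (g : forall u : {set 'I_s}, #|u|.-tuple R -> R)
    (v : {set 'I_k}) (t : #|v|.-tuple R) : R :=
  g (widen_set v) (tcast (card_widen_set v) t).
Arguments truncate_deriv : clear implicits.

Lemma mixed_primitive_truncate (g : forall u : {set 'I_s}, #|u|.-tuple R -> R)
    v (x : k.-tuple R) :
  mixed_primitive (truncate_deriv g v) x =
  mixed_primitive (g (widen_set v)) (zero_pad x).
Proof.
apply: Rintegral_corner_box_tcast => i.
by rewrite enum_val_widen tnth_zero_pad_widen.
Qed.

Variable gamma : {set 'I_s} -> R.
Hypothesis gamma_ge0 : forall u, 0 <= gamma u.
Variables (fu : {set 'I_s} -> s.-tuple R -> R)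
          (g : forall u : {set 'I_s}, #|u|.-tuple R -> R).
Arguments g : clear implicits.
Hypothesis fug : forall u, 0 < gamma u -> Fu_deriv p (fu u) (g u).
Variable f : s.-tuple R -> R.
Hypothesis ffu : forall x, cube x -> f x = \sum_(u | 0 < gamma u) fu u x.

Let in_initial : pred {set 'I_s} := fun u => u \subset initial s k.

Lemma sum_zero_pad x : cube x ->
  f (zero_pad x) = partial_sum gamma fu in_initial (zero_pad x).
Proof.
move=> x01; have zx := cube_zero_pad x01.
rewrite ffu// (bigID in_initial)/= [X in _ + X]big1 ?addr0// => u /andP[u0].
move=> /subsetPn[j ju jk]; have [_ ->] := fug u0; last exact: mem_set.
by apply: (mixed_primitive_anchored _ ju); rewrite tnth_zero_pad0.
Qed.

Lemma truncate_Fu_deriv (v : {set 'I_k}) : 0 < restrict_weights hks gamma v ->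
  Fu_deriv p (fun x => fu (widen_set v) (zero_pad x)) (truncate_deriv g v).
Proof.
move=> v0; have [gc fE] := fug v0; split; first exact: completed_deriv_tcast.
move=> x /set_mem x01; rewrite fE ?mixed_primitive_truncate//.
exact/mem_set/cube_zero_pad.
Qed.

(** Setting the last coordinates to [0] kills exactly the components whose index
    is not included in [k] and keeps the other ones, together with their mixed
    derivatives. *)
Lemma truncate_norm : is_anchored_norm p (restrict_weights hks gamma)
  (truncate (k := k) f)
  (weighted_norm p (restrict_weights hks gamma) (truncate_deriv g)).
Proof.
exists (fun v x => fu (widen_set v) (zero_pad x)), (truncate_deriv g); split => //.
  split => [v v0|x /set_mem x01].
    by exists (truncate_deriv g v); exact: truncate_Fu_deriv.
  by rewrite [LHS]sum_zero_pad// /partial_sum sum_sub_initial.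
by move=> v; exact: truncate_Fu_deriv.
Qed.

Lemma scaled_norm_truncate (v : {set 'I_k}) :
  scaled_norm (restrict_weights hks gamma) p (truncate_deriv g) v =
  scaled_norm gamma p g (widen_set v).
Proof. by rewrite /scaled_norm /truncate_deriv Lp_norm_tcast. Qed.

Lemma lift_truncate x : cube x ->
  lift_fun hks (truncate (k := k) f) x = partial_sum gamma fu in_initial x.
Proof.
move=> x01; rewrite [LHS]sum_zero_pad; last first.
  by move=> i; rewrite tnth_mktuple.
apply: eq_bigr => u /andP[u0 uk].
have [_ fE] := fug u0; rewrite !fE; last 2 first.
- exact: mem_set.
- apply/mem_set/cube_zero_pad => i; rewrite tnth_mktuple; exact: x01.
apply: mixed_primitive_eq => j ju.
have := fintype.subsetP uk _ ju; rewrite inE => jk.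
rewrite (_ : j = widen_ord hks (Ordinal jk)); last exact: val_inj.
by rewrite tnth_zero_pad_widen tnth_mktuple.
Qed.

End truncation.
Arguments truncate_deriv {R s k} hks g v _.

(** * The error of the truncated algorithm *)

Section norm_scaling.
Context {R : realType}.
Variables (s : nat) (gamma : {set 'I_s} -> R).
Hypothesis gamma_ge0 : forall u, 0 <= gamma u.

Lemma is_anchored_normZ (r : R) (c : R) f (N : \bar R) : 1 <= r -> 0 < c ->
  is_anchored_norm r%:E gamma f N ->
  is_anchored_norm r%:E gamma (fun x => c * f x) (c%:E * N)%E.
Proof.
move=> r1 c0 [fu [g [[_ ffu] fug ->]]].
have r0 : r != 0 by rewrite gt_eqF// (lt_le_trans ltr01).
have gp u : 0 < gamma u -> Lp_fun r%:E (g u) by move=> /fug[[]].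
exists (fun u x => c * fu u x), (fun u t => c * g u t); split.
- split => [u u0|x xc]; last by rewrite ffu// mulr_sumr.
  by exists (fun t => c * g u t); exact/Fu_derivZ/fug.
- by move=> u u0; exact/Fu_derivZ/fug.
- have cgp u : 0 < gamma u -> Lp_fun r%:E (fun t => c * g u t).
    by move=> u0; exact/Lp_funZ/gp.
  rewrite (weighted_norm_fin gamma_ge0 r1 gp) (weighted_norm_fin gamma_ge0 r1 cgp).
  rewrite -EFinM; congr EFin.
  have -> : \sum_(u | 0 < gamma u)
      scaled_norm gamma r%:E (fun u t => c * g u t) u `^ r =
      c `^ r * \sum_(u | 0 < gamma u) scaled_norm gamma r%:E g u `^ r.
    rewrite mulr_sumr; apply: eq_bigr => u u0.
    rewrite /scaled_norm Lp_normZ//; last exact: gp.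
    rewrite (Lp_norm_fine (gp _ u0)) -EFinM /= gtr0_norm//.
    by rewrite mulrCA [LHS]powRM ?mulr_ge0 ?invr_ge0 ?Lp_norm_ge0 ?(ltW c0).
  rewrite powRM ?powR_ge0//; last by apply: sumr_ge0 => u _; exact: powR_ge0.
  by rewrite -powRrM divff// powRr1// ltW.
Qed.

End norm_scaling.

Section finite_hoelder.
Context {R : realType}.

(** Iterates the inequality for two terms. *)
Lemma hoelder_sum (I : finType) (P : pred I) (a b : I -> R) (p q : R) :
  (forall i, 0 <= a i) -> (forall i, 0 <= b i) ->
  0 < p -> 0 < q -> p^-1 + q^-1 = 1 ->
  \sum_(i | P i) a i * b i <=
  (\sum_(i | P i) a i `^ p) `^ p^-1 * (\sum_(i | P i) b i `^ q) `^ q^-1.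
Proof.
move=> a0 b0 p0 q0 pq.
suff [//] : [/\ \sum_(i | P i) a i * b i <=
    (\sum_(i | P i) a i `^ p) `^ p^-1 * (\sum_(i | P i) b i `^ q) `^ q^-1,
  0 <= \sum_(i | P i) a i `^ p & 0 <= \sum_(i | P i) b i `^ q].
apply: (big_ind3 (fun x y z =>
  [/\ x <= y `^ p^-1 * z `^ q^-1, 0 <= y & 0 <= z])).
- by rewrite mulr_ge0 ?powR_ge0.
- move=> x1 y1 z1 x2 y2 z2 [h1 y10 z10] [h2 y20 z20].
  rewrite !addr_ge0//; split => //; apply: le_trans (lerD h1 h2) _.
  apply: le_trans (hoelder2 _ _ _ _ p0 q0 pq) _; rewrite ?powR_ge0//.
  by rewrite -!powRrM !mulVf ?gt_eqF// !powRr1.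
- move=> i _; rewrite !powR_ge0 -!powRrM !divff ?gt_eqF// !powRr1//; split => //.
Qed.

End finite_hoelder.

Section error_bound.
Context {R : realType}.
Variables (s : nat) (p q : \bar R) (p1 : (1 <= p)%E) (q1 : (1 <= q)%E).
Variables (gamma : {set 'I_s} -> R) (gamma_ge0 : forall u, 0 <= gamma u).
Variables (L : normedModType R) (emb : (s.-tuple R -> R) -> L).
Hypothesis hemb : Lq_embedding p q gamma emb.
Variables (k : nat) (hks : (k <= s)%N) (A : @algorithm R L k).
Hypothesis hA : p <> +oo%E -> forall (c : R) (h : k.-tuple R -> R), 0 < c ->
  anchored_space p (restrict_weights hks gamma) h ->
  alg_apply A (fun x => c * h x) = c *: alg_apply A h.

Let err_k := worst_case_error p (restrict_weights hks gamma)
  (fun h => emb (lift_fun hks h)) (alg_apply A).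
Let err_trnc := worst_case_error p gamma emb
  (fun f => alg_apply A (truncate (k := k) f)).
Let ps : R := fine (hoelder_conjugate p).
Let gamma_k := restrict_weights hks gamma.

Let head : pred {set 'I_s} := fun u => u \subset initial s k.
Let tail : pred {set 'I_s} := fun u => ~~ (u \subset initial s k).

Lemma restrict_weights_ge0 v : 0 <= gamma_k v.
Proof. exact: gamma_ge0. Qed.

Section one_function.
Variables (f : s.-tuple R -> R) (fu : {set 'I_s} -> s.-tuple R -> R)
          (g : forall u : {set 'I_s}, #|u|.-tuple R -> R).
Arguments g : clear implicits.
Hypothesis fug : forall u, 0 < gamma u -> Fu_deriv p (fu u) (g u).
Hypothesis ffu : forall x, cube x -> f x = \sum_(u | 0 < gamma u) fu u x.

Let head_error :=
  `|emb (partial_sum gamma fu head) - alg_apply A (truncate (k := k) f)|.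

Lemma error_split :
  `|emb f - alg_apply A (truncate (k := k) f)| <=
  head_error + `|emb (partial_sum gamma fu tail)|.
Proof.
have hp := partial_sum_anchored p1 fug.
have fE x : cube x ->
    partial_sum gamma fu head x + partial_sum gamma fu tail x = f x.
  by move=> xc; rewrite ffu// (bigID head).
have -> : emb f = emb (partial_sum gamma fu head) + emb (partial_sum gamma fu tail).
  rewrite -(embD hemb)//; apply: (emb_eq hemb) => [||x xc]; last by rewrite fE.
    apply: (@anchored_space_eq _ _ _ _ (partial_sum gamma fu predT)) => // x xc.
    by rewrite ffu//; apply: eq_bigl => u; rewrite andbT.
  apply: (@anchored_space_eq _ _ _ _ (partial_sum gamma fu predT)) => // x xc.
  by rewrite fE// ffu//; apply: eq_bigl => u; rewrite andbT.
by rewrite addrAC; exact: ler_normD.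
Qed.

Lemma emb_lift_truncate :
  emb (lift_fun hks (truncate (k := k) f)) = emb (partial_sum gamma fu head).
Proof.
have hp := partial_sum_anchored p1 fug.
have E x : cube x -> lift_fun hks (truncate (k := k) f) x =
  partial_sum gamma fu head x by move=> xc; rewrite (lift_truncate hks fug ffu).
apply: (emb_eq hemb) => //.
by apply: (@anchored_space_eq _ _ _ _ (partial_sum gamma fu head)) => // x /E.
Qed.

Lemma head_error_le_ball :
  (weighted_norm p gamma_k (truncate_deriv hks g) <= 1)%E ->
  (head_error%:E <= err_k)%E.
Proof.
move=> N1; apply: ereal_sup_ubound; exists (truncate (k := k) f).
  exists (weighted_norm p gamma_k (truncate_deriv hks g)) => //.
  exact: (truncate_norm hks fug ffu).
by rewrite emb_lift_truncate.
Qed.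

(** This is where the homogeneity of the algorithm is used: the worst case error
    is a supremum over the unit ball, and the truncated function must be rescaled
    into it.  The scale [c] is any upper bound of the norm, as the norm itself
    may be [0]. *)
Lemma head_error_scaled (r c : R) : p = r%:E -> 0 < c ->
  (weighted_norm p gamma_k (truncate_deriv hks g) <= c%:E)%E ->
  ((c^-1 * head_error)%:E <= err_k)%E.
Proof.
move=> pr c0 Nc; have c'0 : 0 < c^-1 by rewrite invr_gt0.
have hN := truncate_norm hks fug ffu.
apply: ereal_sup_ubound; exists (fun x => c^-1 * truncate (k := k) f x).
  exists (c^-1%:E * weighted_norm p gamma_k (truncate_deriv hks g))%E.
    have r1 : 1 <= r by rewrite -lee_fin -pr.
    by move: hN; rewrite pr; apply: is_anchored_normZ => //; exact: restrict_weights_ge0.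
  by rewrite lee_pdivrMl// mule1.
have ht : anchored_space p (restrict_weights hks gamma) (truncate (k := k) f).
  by case: hN => fk [gk [h _ _]]; exists fk.
rewrite hA//; last by rewrite pr.
rewrite -[lift_fun _ _]/(fun x => c^-1 * lift_fun hks (truncate (k := k) f) x).
rewrite (embZ p1 hemb) ?emb_lift_truncate.
  by rewrite -scalerBr normrZ gtr0_norm.
apply: (@anchored_space_eq _ _ _ _ (partial_sum gamma fu head)).
  exact: (partial_sum_anchored p1 fug).
by move=> x xc; rewrite (lift_truncate hks fug ffu).
Qed.

Lemma weighted_norm_truncate (r : R) : p = r%:E ->
  weighted_norm p gamma_k (truncate_deriv hks g) =
  ((\sum_(u | (0 < gamma u) && head u) scaled_norm gamma p g u `^ r) `^ r^-1)%:E.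
Proof.
move=> pr; have r1 : 1 <= r by rewrite -lee_fin -pr.
have gkp v : 0 < gamma_k v -> Lp_fun r%:E (truncate_deriv hks g v).
  by move=> v0; rewrite -pr; have [[]] := truncate_Fu_deriv fug v0.
rewrite pr (weighted_norm_fin restrict_weights_ge0 r1 gkp).
rewrite sum_sub_initial; congr (_ `^ _)%:E; apply: eq_bigr => v _.
by rewrite scaled_norm_truncate.
Qed.

Lemma err_k_ge0 (r : R) : p = r%:E -> (0 <= err_k)%E.
Proof.
move=> pr; have NE := weighted_norm_truncate pr; set N := (X in X%:E) in NE.
have N10 : 0 < N + 1 by rewrite ltr_wpDl// powR_ge0.
apply: le_trans (head_error_scaled pr N10 _).
  by rewrite lee_fin mulr_ge0 ?invr_ge0 ?(ltW N10)//; exact: normr_ge0.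
by rewrite NE lee_fin lerDl.
Qed.

(** Letting the scale decrease to the norm; when the norm is [0] this limit says
    that the error is [0]. *)
Lemma head_error_le (r E : R) : p = r%:E -> err_k = E%:E ->
  head_error <= E *
    (\sum_(u | (0 < gamma u) && head u) scaled_norm gamma p g u `^ r) `^ r^-1.
Proof.
move=> pr errE; have NE := weighted_norm_truncate pr.
have E0 : 0 <= E by rewrite -lee_fin -errE; exact: err_k_ge0 pr.
move: NE; set N := _ `^ r^-1 => NE.
have N0 : 0 <= N by exact: powR_ge0.
have bound c : 0 < c -> N <= c -> head_error <= c * E.
  move=> c0 Nc; rewrite -ler_pdivrMl// -lee_fin -errE.
  by apply: (head_error_scaled pr c0); rewrite NE lee_fin.
apply/ler_addgt0Pr => e e0.
have E10 : 0 < E + 1 by rewrite ltr_wpDl.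
apply: le_trans (bound (N + e / (E + 1)) _ _) _.
- by rewrite ltr_wpDl// divr_gt0.
- by rewrite lerDl divr_ge0// ltW.
rewrite mulrDl mulrC lerD2l mulrAC ler_pdivrMr// ler_pM2l//.
by rewrite lerDl.
Qed.

End one_function.

(** The error splits into the error of [A] on the truncated function, at most
    [err_k] times the norm of the head, and the L_q norm of the tail, at most
    [B] times the norm of the tail.  The p-th powers of the two norms add up to
    at most 1, so Hoelder's inequality for two terms concludes.  For [p = +oo]
    both norms are at most 1 and the two errors simply add up. *)
Lemma trunc_error_bound (B : R) : 0 <= B ->
  (forall (fu : {set 'I_s} -> s.-tuple R -> R)
          (g : forall u : {set 'I_s}, #|u|.-tuple R -> R),
    (forall u, 0 < gamma u -> Fu_deriv p (fu u) (g u)) ->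
    (`|emb (partial_sum gamma fu tail)|%:E <=
      B%:E * weighted_norm p gamma (restrict_deriv tail g))%E) ->
  (err_trnc <= if p == 1%E then maxe err_k B%:E
               else (err_k `^ ps + (B `^ ps)%:E) `^ ps^-1)%E.
Proof.
move=> B0 hB; apply: ge_ereal_sup => _ [f [N [fu [g [[_ ffu'] fug ->]]] N1] <-].
have ffu x : cube x -> f x = \sum_(u | 0 < gamma u) fu u x.
  by move=> xc; apply: ffu'; exact: mem_set.
have := hB fu g fug; have := error_split fug ffu.
set x := `|emb (partial_sum gamma fu head) - _|.
set y := `|emb (partial_sum gamma fu tail)|; set z := `|_ - _|.
move=> zxy yB; apply: (@le_trans _ _ (x + y)%:E); first by rewrite lee_fin.
have x0 : 0 <= x by exact: normr_ge0.
have gp u : 0 < gamma u -> Lp_fun p (g u) by move=> /fug[[]].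
have [pE|pE] := eqVneq p +oo%E.
- have gy u : 0 < gamma u -> Lp_fun +oo%E (g u) by rewrite -pE; exact: gp.
  move: N1; rewrite pE => /(weighted_norm_infty_le ler01 gy) n1.
  have xerr : (x%:E <= err_k)%E.
    apply: (head_error_le_ball fug ffu); rewrite pE.
    apply/weighted_norm_infty_le => // [v v0|v v0].
    - by rewrite -pE; have [[]] := truncate_Fu_deriv fug v0.
    - by rewrite scaled_norm_truncate; exact: n1.
  have yB1 : (y%:E <= B%:E)%E.
    apply: le_trans yB _; rewrite -[leRHS]mule1 lee_wpmul2l ?lee_fin// pE.
    apply/weighted_norm_infty_le => // [u u0|u u0].
      by rewrite /restrict_deriv; case: (tail u); [exact: gy|apply: Lp_fun0; rewrite leey].
    by rewrite scaled_norm_restrict ?leey//; case: (tail u) => //; exact: n1.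
  have err0 : (0 <= err_k)%E by apply: le_trans xerr; rewrite lee_fin.
  rewrite /ps pE hoelder_conjugatey /= invr1 powRr1// (poweRe1 err0).
  by rewrite poweRe1 ?adde_ge0 ?lee_fin// EFinD leeD.
have [r pr] : exists r, p = r%:E.
  by move: p1 pE; case: (p) => [r| |]//; exists r.
have r1 : 1 <= r by rewrite -lee_fin -pr.
have r0 : 0 < r by rewrite (lt_le_trans ltr01).
have gr u : 0 < gamma u -> Lp_fun r%:E (g u) by rewrite -pr; exact: gp.
set n := scaled_norm gamma r%:E g.
pose H := \sum_(u | (0 < gamma u) && head u) n u `^ r.
pose T := \sum_(u | (0 < gamma u) && tail u) n u `^ r.
have H0 : 0 <= H by apply: sumr_ge0 => u _; exact: powR_ge0.
have T0 : 0 <= T by apply: sumr_ge0 => u _; exact: powR_ge0.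
have HT1 : H + T <= 1.
  move: N1; rewrite pr (weighted_norm_fin gamma_ge0 r1 gr) lee_fin (bigID head)/=.
  rewrite -/n -/H -/T => HT.
  have -> : H + T = ((H + T) `^ r^-1) `^ r.
    by rewrite -powRrM mulVf ?gt_eqF// powRr1// addr_ge0.
  rewrite -[leRHS](congr1 (@^~ r) (powR1 R)) ge0_ler_powR// ?nnegrE ?powR_ge0//.
  exact: ltW.
have yT : y <= B * T `^ r^-1.
  rewrite -lee_fin EFinM; move: yB.
  by rewrite pr (weighted_norm_restrict_fin gamma_ge0 _ r1 gr).
have err0 := err_k_ge0 fug ffu pr.
have hErr E := @head_error_le f fu g fug ffu r E pr.
have [r1E|rn1] := eqVneq r 1.
  rewrite pr r1E eqxx; case errE : err_k err0 hErr => [E| |]// E0 hErr; last first.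
    by rewrite max_l ?leey.
  have := hErr E erefl; rewrite pr -/n -/H -/x => xH.
  rewrite -EFin_max lee_fin; set M := Num.max E B.
  have M0 : 0 <= M by rewrite le_max B0 orbT.
  move: xH yT; rewrite r1E invr1 !powRr1// => xH yT.
  apply: le_trans (lerD xH yT) _.
  apply: (@le_trans _ _ (M * (H + T))); last by rewrite ler_piMr.
  by rewrite mulrDr lerD// ler_wpM2r// le_max lexx ?orbT.
have r1' : 1 < r by rewrite lt_neqAle eq_sym rn1.
have [ps0 psr] : 0 < ps /\ r^-1 + ps^-1 = 1.
  by rewrite /ps pr; exact: fine_hoelder_conjugate_EFin.
rewrite addrC in psr.
rewrite pr eqe (negPf rn1).
case errE : err_k err0 hErr => [E| |]// E0 hErr; last first.
  by rewrite poweRyr ?gt_eqF// addye// poweRyr ?leey// invr_neq0 ?gt_eqF.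
have := hErr E erefl; rewrite pr -/n -/H -/x => xH.
rewrite !poweR_EFin lee_fin; apply: le_trans (lerD xH yT) _.
apply: le_trans (hoelder2 _ _ _ _ ps0 r0 psr) _; rewrite ?powR_ge0//.
rewrite -!powRrM !mulVf ?gt_eqF// !powRr1// ler_piMr ?powR_ge0//.
by rewrite -[leRHS](congr1 (@^~ r^-1) (powR1 R)) ge0_ler_powR// ?nnegrE ?addr_ge0// invr_ge0 ltW.
Qed.

End error_bound.

(** * The norm of the tail *)

Lemma ler_sum_andl (R : realType) (I : finType) (Q P : pred I) (F : I -> R) :
  (forall i, 0 <= F i) ->
  \sum_(i | Q i && P i) F i <= \sum_(i | P i) F i.
Proof.
move=> F0; rewrite [leRHS](bigID Q)/=.
under [X in _ <= X + _]eq_bigl do rewrite andbC.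
by rewrite lerDl sumr_ge0.
Qed.
Section tail_bound.
Context {R : realType}.
Variables (s : nat) (p q : \bar R) (p1 : (1 <= p)%E) (q1 : (1 <= q)%E).
Variables (gamma : {set 'I_s} -> R) (gamma_ge0 : forall u, 0 <= gamma u).
Variables (L : normedModType R) (emb : (s.-tuple R -> R) -> L).
Hypothesis hemb : Lq_embedding p q gamma emb.
Variables (fu : {set 'I_s} -> s.-tuple R -> R)
          (g : forall u : {set 'I_s}, #|u|.-tuple R -> R).
Arguments g : clear implicits.
Hypothesis fug : forall u, 0 < gamma u -> Fu_deriv p (fu u) (g u).
Variable P : pred {set 'I_s}.

Let ps := fine (hoelder_conjugate p).

(** The norm of the embedding of F_u, measured in the weighted norm, is at most
    this number. *)
Definition emb_const u : R :=
  gamma u / Lq_factor q (fine (hoelder_conjugate p)) ^+ #|u|.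

Lemma emb_const_ge0 u : 0 <= emb_const u.
Proof.
rewrite divr_ge0// exprn_ge0// ltW// Lq_factor_gt0//.
exact: fine_hoelder_conjugate_ge0.
Qed.

Lemma emb_partial_sum_le : `|emb (partial_sum gamma fu P)| <=
  \sum_(u | (0 < gamma u) && P u) scaled_norm gamma p g u * emb_const u.
Proof.
rewrite (emb_partial_sum p1 hemb fug); apply: le_trans (ler_norm_sum _ _ _) _.
apply: ler_sum => u /andP[u0 _].
apply: le_trans (emb_Fu_le p1 q1 hemb u0 (fug u0)) _.
rewrite /scaled_norm /emb_const mulrCA !mulrA mulfV ?gt_eqF// mul1r.
by rewrite lexx.
Qed.

(** Hoelder's inequality for sums; at [p = +oo] every scaled norm is at most their
    maximum, which has to be seen to be finite before it is factored out. *)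
Lemma emb_partial_sum_le_hoelder : (1 < p)%E ->
  (`|emb (partial_sum gamma fu P)|%:E <=
    ((\sum_(u | P u) emb_const u `^ ps) `^ ps^-1)%:E *
    weighted_norm p gamma (restrict_deriv P g))%E.
Proof.
move=> p1'; have := emb_partial_sum_le.
have gp u : 0 < gamma u -> Lp_fun p (g u) by move=> /fug[[]].
have [pE|pE] := eqVneq p +oo%E.
  have psE : ps = 1 by rewrite /ps pE hoelder_conjugatey.
  rewrite psE invr1 powRr1; last by apply: sumr_ge0 => u _; exact: powR_ge0.
  under [X in (_ <= X%:E * _)%E]eq_bigr do rewrite powRr1 ?emb_const_ge0//.
  move=> h.
  have gr u : 0 < gamma u -> Lp_fun +oo%E (restrict_deriv P g u).
    rewrite -pE => u0; rewrite /restrict_deriv; case: (P u); first exact: gp.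
    exact: Lp_fun0.
  set W := weighted_norm _ _ _.
  have W0 : (0 <= W)%E.
    rewrite /W pE /weighted_norm; apply: (big_ind (fun x => (0 <= x)%E)) => //.
      by move=> x y x0 y0; rewrite le_max x0.
    by move=> u u0; rewrite mule_ge0 ?lee_fin ?invr_ge0// Lnorm_ge0.
  have WE : W = (fine W)%:E.
    rewrite fineK// ge0_fin_numE//.
    pose M := \sum_(u | 0 < gamma u) scaled_norm gamma p (restrict_deriv P g) u.
    apply: (@le_lt_trans _ _ M%:E); last exact: ltry.
    rewrite /W pE; apply/weighted_norm_infty_le => //.
      by apply: sumr_ge0 => u _; rewrite scaled_norm_ge0.
    move=> u u0; rewrite /M pE (bigD1 u)//= lerDl.
    by apply: sumr_ge0 => v _; rewrite scaled_norm_ge0.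
  have W0' : 0 <= fine W by rewrite fine_ge0.
  have nW u : 0 < gamma u -> P u -> scaled_norm gamma p g u <= fine W.
    move=> u0 Pu; have := lexx W; rewrite {2}WE {1}/W pE.
    move=> /(weighted_norm_infty_le W0' gr)/(_ u u0).
    by rewrite scaled_norm_restrict ?leey// Pu.
  rewrite WE -EFinM lee_fin; apply: le_trans h _.
  apply: (@le_trans _ _
      ((\sum_(u | (0 < gamma u) && P u) emb_const u) * fine W)).
    rewrite mulr_suml; apply: ler_sum => u /andP[u0 Pu].
    by rewrite mulrC ler_wpM2l ?emb_const_ge0// nW.
  by rewrite ler_wpM2r//; apply: ler_sum_andl => u; exact: emb_const_ge0.
have [r pr] : exists r, p = r%:E.
  by move: p1 pE; case: (p) => [r| |]//; exists r.
have r1 : 1 < r by rewrite -lte_fin -pr.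
have r0 : 0 < r by rewrite (lt_trans ltr01).
have gr u : 0 < gamma u -> Lp_fun r%:E (g u) by rewrite -pr; exact: gp.
have [ps0 psr] : 0 < ps /\ r^-1 + ps^-1 = 1.
  by rewrite /ps pr; exact: fine_hoelder_conjugate_EFin.
rewrite [weighted_norm _ _ _](_ : _ =
    ((\sum_(u | (0 < gamma u) && P u) scaled_norm gamma p g u `^ r) `^ r^-1)%:E).
  rewrite -EFinM lee_fin => /le_trans; apply.
  apply: le_trans (hoelder_sum _ _ _ r0 ps0 psr) _ => [u|u|].
  - by rewrite scaled_norm_ge0.
  - exact: emb_const_ge0.
  rewrite mulrC ler_wpM2r ?powR_ge0// ge0_ler_powR ?nnegrE ?invr_ge0 ?(ltW ps0)//.
  - by apply: sumr_ge0 => u _; exact: powR_ge0.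
  - by apply: sumr_ge0 => u _; exact: powR_ge0.
  by apply: ler_sum_andl => u; exact: powR_ge0.
by rewrite pr (weighted_norm_restrict_fin gamma_ge0 _ (ltW r1) gr).
Qed.

(** At [p = 1] the constant of the embedding of F_u is just [gamma u]. *)
Lemma emb_partial_sum_le_max : p = 1%E ->
  (`|emb (partial_sum gamma fu P)|%:E <=
    (\big[maxr/0]_(u : {set 'I_s} | P u) gamma u)%:E *
    weighted_norm p gamma (restrict_deriv P g))%E.
Proof.
move=> pE; have := emb_partial_sum_le.
have gr u : 0 < gamma u -> Lp_fun 1%:E (g u) by move=> /fug[[+ _] _]; rewrite pE.
rewrite [weighted_norm _ _ _](_ : _ =
    (\sum_(u | (0 < gamma u) && P u) scaled_norm gamma p g u)%:E); last first.
  rewrite pE (weighted_norm_restrict_fin gamma_ge0 _ (lexx 1) gr) invr1 powRr1.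
    by congr EFin; apply: eq_bigr => u _; rewrite powRr1// scaled_norm_ge0.
  by apply: sumr_ge0 => u _; exact: powR_ge0.
rewrite -EFinM lee_fin => /le_trans; apply; rewrite mulr_sumr.
apply: ler_sum => u /andP[u0 Pu]; rewrite mulrC ler_wpM2r ?scaled_norm_ge0//.
(* The conjugate exponent +oo is read as [0], and [q / 0 = 0]. *)
rewrite /emb_const pE hoelder_conjugate1 /= (_ : Lq_factor q 0 = 1).
  by rewrite expr1n divr1; exact: (le_bigmax_cond _ gamma Pu).
by case: (q) => [t| |]//=; rewrite invr0 mulr0 add0r powR1.
Qed.

End tail_bound.

(** A partial sum over indices not included in the first [d] coordinates is its own
    tail, once the components with other indices are replaced by [0].  In
    particular the truncation property passes from [d] to any [k >= d]. *)
Lemma truncation_property_partial_sum (R : realType) (s : nat) (p : \bar R)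
    (gamma : {set 'I_s} -> R) (L : normedModType R)
    (emb : (s.-tuple R -> R) -> L) (e : R) (d : nat)
    (fu : {set 'I_s} -> s.-tuple R -> R)
    (g : forall u : {set 'I_s}, #|u|.-tuple R -> R) (P : pred {set 'I_s}) :
  (1 <= p)%E -> truncation_property p gamma emb e d ->
  (forall u, 0 < gamma u -> Fu_deriv p (fu u) (g u)) ->
  (forall u, P u -> ~~ (u \subset initial s d)) ->
  (`|emb (partial_sum gamma fu P)|%:E <=
    e%:E * weighted_norm p gamma (restrict_deriv P g))%E.
Proof.
move=> p1 td fug Pd.
have := td _ _ (partial_sum_decomposition p1 fug P).
set tl := (fun x => \sum_(u | _) _).
have -> : tl = partial_sum gamma fu P.
  apply/funext => x; rewrite /tl /partial_sum [LHS]big_mkcondr [RHS]big_mkcondr.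
  apply: eq_bigr => u _; rewrite /restrict_fun.
  by case: ifPn => // ud; case: ifPn => // /Pd; rewrite (negPf ud).
by apply; exact: partial_sum_norm.
Qed.

Theorem theorem2 (R : realType) (s : nat) (p q : \bar R)
    (hp : (1 <= p)%E) (hq : (1 <= q)%E)
    (gamma : {set 'I_s} -> R) (hgamma : forall u : {set 'I_s}, 0 <= gamma u)
    (L : normedModType R) (emb : (s.-tuple R -> R) -> L)
    (hemb : Lq_embedding p q gamma emb)
    (k : nat) (hk : (1 <= k)%N) (hks : (k < s)%N)
    (A : @algorithm R L k)
    (hA : p <> +oo%E -> forall (c : R) (h : k.-tuple R -> R), 0 < c ->
       anchored_space p (restrict_weights (ltnW hks) gamma) h ->
       alg_apply A (fun x => c * h x) = c *: alg_apply A h) :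
  let err_k := worst_case_error p (restrict_weights (ltnW hks) gamma)
                 (fun h => emb (lift_fun (ltnW hks) h)) (alg_apply A) in
  let err_trnc := worst_case_error p gamma emb
                    (fun f => alg_apply A (truncate (k := k) f)) in
  let ps : R := fine (hoelder_conjugate p) in
  [/\ (1 < p)%E ->
        (err_trnc <=
          (err_k `^ ps +
             (\sum_(u : {set 'I_s} | ~~ (u \subset initial s k))
                gamma u `^ ps / Lq_factor q ps `^ (ps * #|u|%:R))%:E) `^ ps^-1)%E,
      p = 1%E ->
        (err_trnc <=
          maxe err_k
            (\big[maxr/0]_(u : {set 'I_s} | ~~ (u \subset initial s k)) gamma u)%:E)%E
    & forall (e : R) (d : nat), 0 < e ->
        is_trunc_dim p gamma emb e d -> (d <= k)%N ->
        (err_trnc <=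
          if p == 1%E then maxe err_k e%:E
          else (err_k `^ ps + (e `^ ps)%:E) `^ ps^-1)%E].
Proof.
move=> err_k err_trnc ps.
have bound := trunc_error_bound hp hgamma hemb hA.
have tail_sub : forall u : {set 'I_s}, ~~ (u \subset initial s k) ->
    emb_const p q gamma u `^ ps =
    gamma u `^ ps / Lq_factor q ps `^ (ps * #|u|%:R).
  move=> u _.
  have f0 := Lq_factor_gt0 hq (fine_hoelder_conjugate_ge0 hp).
  rewrite /emb_const -/ps powRM ?hgamma ?invr_ge0 ?exprn_ge0 ?(ltW f0)//.
  congr (_ * _); rewrite -powR_mulrn ?(ltW f0)// -powRN -powRrM mulNr powRN.
  by rewrite mulrC.
split.
- move=> p1; set S := \sum_(u | _) _.
  have S0 : 0 <= S.
    by apply: sumr_ge0 => u _; rewrite divr_ge0 ?powR_ge0.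
  have ps0 : ps != 0 by rewrite gt_eqF// fine_hoelder_conjugate_gt0.
  have := bound (S `^ ps^-1) (powR_ge0 _ _).
  rewrite gt_eqF// -powRrM mulVf// powRr1//; apply => fu g fug.
  have := emb_partial_sum_le_hoelder hp hq hgamma hemb fug
    (fun u => ~~ (u \subset initial s k)) p1.
  by under eq_bigr do rewrite tail_sub//.
- move=> p1; have := bound (\big[maxr/0]_(u : {set 'I_s} | ~~ (u \subset initial s k)) gamma u).
  rewrite ifT; last exact/eqP.
  apply.
    apply: (big_ind (fun x => 0 <= x)) => // x y x0 y0.
    by rewrite le_max x0.
  move=> fu g fug.
  exact: (emb_partial_sum_le_max hp hq hgamma hemb).
- move=> e d e0 [td _] dk; apply: bound; first exact: ltW.
  move=> fu g fug; apply: (truncation_property_partial_sum hp td fug) => u.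
  apply: contraNN => /fintype.subset_trans; apply.
  by apply/fintype.subsetP => j; rewrite !inE => /leq_trans; apply.
Qed.
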